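(* Write $\eta_u=\eta(u,0)$ and assume each coordinate $u_a$ is a polynomial in $\eta_u$, i.e. $u\in\mathbb{R}[\eta_u]$. Let $\tilde e_1(\eta),\dots,\tilde e_p(\eta)\in\mathbb{R}[\eta]^d$ be such that $\tilde e_1(\eta_u),\dots,\tilde e_p(\eta_u)$ span $((\nabla_u\eta(u,0))^{\perp_{\bar G}})^{\perp_E}$ for every $u$. Let $$\mathcal{I}_3=\langle (X_i-\eta_i)(X_j-\eta_j)(X_k-\eta_k)\mid 1\le i,j,k\le d\rangle\subset\mathbb{R}[X,\eta]=\mathbb{R}[X_1,\dots,X_d,\eta_1,\dots,\eta_d],$$ let $\prec$ be the pure lexicographic monomial order with $\eta_1\succ\dots\succ\eta_d\succ X_1\succ\dots\succ X_d$, let $G_\prec$ be a Gröbner basis of $\mathcal{I}_3$ with respect to $\prec$, and for $j=1,\dots,p$ let $r_j\in\mathbb{R}[X,\eta]$ be the normal form (remainder) of $(X-\eta)^\top\tilde e_j(\eta)$ with respect to $G_\prec$. Then: 1. for $j=1,\dots,p$, $r_j$ has degree at most $2$ with respect to $\eta$ (total degree in $\eta_1,\dots,\eta_d$); 2. $r_j(X,\eta_u)=0$, $j=1,\dots,p$, are the estimating equations for a second-order efficient estimator.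
   Context: Full exponential family: $dP(x|\theta)=\exp(\sum_i x_i\theta^i-\psi(\theta))\,d\nu$, $x\in\mathbb{R}^d$, $\theta\in\Theta\subset\mathbb{R}^d$, with smooth potential $\psi$. The expectation parameter is $\eta(\theta)=\nabla_\theta\psi(\theta)$, locally invertible with inverse $\theta(\eta)$. The Fisher metric with respect to $\theta$ is $g_{ij}=\partial^2\psi/\partial\theta^i\partial\theta^j$ (positive definite), and $\bar G(\eta)=(g^{ij})$ is its inverse matrix, the Fisher metric with respect to $\eta$. The model is an algebraic curved exponential family of dimension $p<d$ with expectation parameter space $\mathcal{V}_E\subset\mathbb{R}^d$, nonsingular around the true parameter; here algebraic means that $\mathcal V_E$ or the natural parameter space is a real algebraic variety and the relation between $\theta$ and $\eta$ is locally given by polynomial equations. $u\mapsto\eta(u,0)$, $u$ in a subset of $\mathbb{R}^p$, is a regular parametrization of $\mathcal{V}_E$ around the true parameter. $X\in\mathbb{R}^d$ denotes the sample mean. $(\nabla_u\eta(u,0))^{\perp_{\bar G}}$ is the subspace of $\mathbb{R}^d$ orthogonal, with respect to $\bar G(\eta(u,0))$, to $\mathrm{span}(\partial_{u^a}\eta(u,0))_{a=1}^p$; $(\cdot)^{\perp_E}$ is the Euclidean orthogonal complement. An estimator is given by a local coordinate system $(u,v)\in\mathbb{R}^p\times\mathbb{R}^{d-p}$, $(u,v)\mapsto\eta(u,v)\in\mathbb{R}^d$ (smooth), around the true parameter, extending the parametrization $\eta(u,0)$ of $\mathcal{V}_E$; the estimate from $X=\eta(u,v)$ is $u$. The estimator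 defined by a system of equations in $(X,u)$ (its estimating equations) is such a coordinate system (with any choice of the coordinates $v$) for which the equations hold identically when $X=\eta(u,v)$ is substituted. With $\theta(u,v)=\theta(\eta(u,v))$, the estimator is called second-order efficient if $$\left.\sum_{i=1}^d\frac{\partial^2\eta_i(u,v)}{\partial v^\kappa\,\partial v^\lambda}\,\frac{\partial\theta^i(u,v)}{\partial u^a}\right|_{v=0}=0\quad\text{for all }\kappa,\lambda\in\{1,\dots,d-p\},\ a\in\{1,\dots,p\}.$$ *)

(* Defs.v *)
From HB Require Import structures.
From mathcomp Require Import all_boot all_order all_algebra.
(* The notations of [mpoly] clash with those of MathComp-Analysis. *)
From mathcomp Require Import -(notations) mpoly.
From mathcomp Require Import all_classical all_reals all_analysis.
Set Implicit Arguments.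
Unset Strict Implicit.
Unset Printing Implicit Defensive.
Import Order.TTheory GRing.Theory Num.Theory numFieldNormedType.Exports.
Local Open Scope classical_set_scope.
Local Open Scope ring_scope.

(** * Smooth maps *)

(* Meant for finite-dimensional [V], where pointwise continuity of all the
   directional derivatives ['d f x v] is continuity of the derivative; [U] is
   meant to be open. *)
Fixpoint Ck (R : realType) (V W : normedModType R) (k : nat) (U : set V)
    (f : V -> W) : Prop :=
  if k is k'.+1 then
    (forall x, U x -> differentiable f x) /\
    (forall v : V, Ck k' U (fun x => 'd f x v))
  else forall x, U x -> {for x, continuous f}.

Definition smooth_on (R : realType) (V W : normedModType R) (U : set V)
    (f : V -> W) : Prop := forall k, Ck k U f.

(* [f] is a diffeomorphism from the open set [O] onto the open set [f @` O],
   and [g] is its inverse there. *)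
Definition diffeo_with_inverse (R : realType) (V W : normedModType R)
    (O : set V) (f : V -> W) (g : W -> V) : Prop :=
  [/\ open O, smooth_on O f, open (f @` O), smooth_on (f @` O) g
    & forall x, O x -> g (f x) = x].

Definition evec (R : realType) (n : nat) (i : 'I_n) : 'rV[R]_n := delta_mx 0 i.

Definition grad (R : realType) (d : nat) (psi : 'rV[R]_d -> R) (t : 'rV[R]_d) :
  'rV[R]_d := \row_i 'D_(evec R i) psi t.

Definition hessian (R : realType) (d : nat) (psi : 'rV[R]_d -> R)
    (t : 'rV[R]_d) : 'M[R]_d :=
  \matrix_(i, j) 'D_(evec R i) ('D_(evec R j) psi) t.

Definition posdef (R : realType) (d : nat) (A : 'M[R]_d) : Prop :=
  A^T = A /\ forall x : 'rV[R]_d, x != 0 -> 0 < (x *m A *m x^T) 0 0.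

(** * Exponential families *)

Notation borel_rV R d := (g_sigma_algebraType (@open 'rV[R]_d)).

Definition expfam_law (R : realType) (d : nat)
    (nu : {measure set (borel_rV R d) -> \bar R}) (psi : 'rV[R]_d -> R)
    (t : 'rV[R]_d) (A : set (borel_rV R d)) : \bar R :=
  (\int[nu]_(x in A)
     (expR (\sum_i (x : 'rV[R]_d) 0 i * t 0 i - psi t))%:E)%E.

Record exponential_family (R : realType) (d : nat)
    (nu : {measure set (borel_rV R d) -> \bar R})
    (Theta : set 'rV[R]_d) (psi : 'rV[R]_d -> R) : Prop := {
  expfam_open : open Theta;
  expfam_probability : forall t, Theta t -> expfam_law nu psi t setT = 1%E;
  expfam_smooth : smooth_on Theta psi;
  expfam_fisher_posdef : forall t, Theta t -> posdef (hessian psi t) }.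

(* The Fisher metric with respect to the expectation parameter, [th] being the
   inverse of the map from natural to expectation parameters. *)
Definition fisher_eta (R : realType) (d : nat) (psi : 'rV[R]_d -> R)
    (th : 'rV[R]_d -> 'rV[R]_d) (y : 'rV[R]_d) : 'M[R]_d :=
  invmx (hessian psi (th y)).

Definition algebraic_in (R : realType) (d : nat) (H V : set 'rV[R]_d) : Prop :=
  exists (s : nat) (F : 'I_s -> mpoly d R),
    V = [set y | H y /\ forall k, meval (y 0) (F k) = 0].

Definition nonsingular_around (R : realType) (d p : nat) (V : set 'rV[R]_d)
    (y0 : 'rV[R]_d) : Prop :=
  exists (N : set 'rV[R]_d) (f : 'rV[R]_d -> 'rV[R]_(d - p)),
    [/\ open N, N y0, smooth_on N f,
        forall y, N y -> (V y <-> f y = 0)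
      & forall y, N y -> \rank (jacobian f y) = (d - p)%N].

(* [VE] is the expectation parameter space of the model and [t0] the natural
   parameter of the true distribution. *)
Record algebraic_curved_family (R : realType) (d p : nat)
    (Theta : set 'rV[R]_d) (psi : 'rV[R]_d -> R) (VE : set 'rV[R]_d)
    (t0 : 'rV[R]_d) : Prop := {
  curved_sub : VE `<=` grad psi @` Theta;
  curved_true : Theta t0 /\ VE (grad psi t0);
  curved_algebraic : algebraic_in (grad psi @` Theta) VE \/
    algebraic_in Theta [set t | Theta t /\ VE (grad psi t)];
  curved_relation : exists (s : nat) (h : 'I_s -> mpoly (d + d) R),
    \forall z \near (t0, grad psi t0),
      (forall k, meval (row_mx z.1 z.2 0) (h k) = 0) <-> z.2 = grad psi z.1;
  curved_nonsingular : nonsingular_around p VE (grad psi t0) }.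

Record regular_parametrization (R : realType) (d p : nat) (VE : set 'rV[R]_d)
    (y0 : 'rV[R]_d) (U : set 'rV[R]_p) (u0 : 'rV[R]_p)
    (etaE : 'rV[R]_p -> 'rV[R]_d) : Prop := {
  param_open : open U;
  param_true : U u0 /\ etaE u0 = y0;
  param_smooth : smooth_on U etaE;
  param_regular : forall u, U u -> \rank (jacobian etaE u) = p;
  param_inj : set_inj U etaE;
  param_sub : etaE @` U `<=` VE;
  param_onto : \forall y \near y0, VE y -> (etaE @` U) y }.

(** * Estimators *)

(* [H (u, v)] is the point with coordinates [(u, v)]; [W] is the domain of
   expectation parameters on which the inverse map to the natural parameter is
   defined. *)
Record estimator (R : realType) (d p q : nat) (U : set 'rV[R]_p)
    (u0 : 'rV[R]_p) (etaE : 'rV[R]_p -> 'rV[R]_d) (W : set 'rV[R]_d)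
    (O : set ('rV[R]_p * 'rV[R]_q)) (H : 'rV[R]_p * 'rV[R]_q -> 'rV[R]_d) :
    Prop := {
  estimator_true : O (u0, 0);
  estimator_coord : exists K, diffeo_with_inverse O H K;
  estimator_range : H @` O `<=` W;
  estimator_domain : forall u v, O (u, v) -> U u;
  estimator_extends : forall u, O (u, 0) -> H (u, 0) = etaE u }.

Definition second_order_efficient (R : realType) (d p q : nat)
    (th : 'rV[R]_d -> 'rV[R]_d)
    (O : set ('rV[R]_p * 'rV[R]_q)) (H : 'rV[R]_p * 'rV[R]_q -> 'rV[R]_d) :
    Prop :=
  forall u, O (u, 0) -> forall (k l : 'I_q) (a : 'I_p),
    \sum_(i < d)
      'D_(evec R k) ('D_(evec R l) (fun v : 'rV[R]_q => H (u, v) 0 i)) 0 *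
      'D_(evec R a) (fun u' : 'rV[R]_p => th (H (u', 0)) 0 i) u = 0.

(** * Groebner bases for the pure lexicographic order *)

(* The variable of index 0 is the largest one. *)
Definition lex_le (n : nat) (m1 m2 : multinom n) : bool :=
  ((multinom_val m1 : n.-tuplelexi nat) <=
   (multinom_val m2 : n.-tuplelexi nat))%O.

Definition lex_max (n : nat) (m1 m2 : multinom n) : multinom n :=
  if lex_le m1 m2 then m2 else m1.

(* Both are trivial at [0]: [lex_lm 0 = 1] and [lex_lt 0 = 0]. *)
Definition lex_lm (n : nat) (R : realType) (f : mpoly n R) : multinom n :=
  \big[@lex_max n / mnm0]_(m <- msupp f) m.

Definition lex_lt (n : nat) (R : realType) (f : mpoly n R) : mpoly n R :=
  mcoeff (lex_lm f) f *: mpolyX R (lex_lm f).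

Definition in_ideal (n : nat) (R : realType) (I : finType)
    (g : I -> mpoly n R) (f : mpoly n R) : Prop :=
  exists c : I -> mpoly n R, f = \sum_i c i * g i.

Definition groebner_basis (n : nat) (R : realType) (I : mpoly n R -> Prop)
    (s : nat) (g : 'I_s -> mpoly n R) : Prop :=
  (forall i, I (g i)) /\
  (forall f, I f -> in_ideal (fun i => lex_lt (g i)) (lex_lt f)).

Definition is_remainder (n : nat) (R : realType) (s : nat)
    (g : 'I_s -> mpoly n R) (f r : mpoly n R) : Prop :=
  exists q : 'I_s -> mpoly n R,
    [/\ f = \sum_i q i * g i + r,
        forall i, q i * g i != 0 -> lex_le (lex_lm (q i * g i)) (lex_lm f)
      & forall m, m \in msupp r -> forall i, g i != 0 ->
          ~ (forall k, (lex_lm (g i) k <= m k)%N)].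

(** * The ring R[X, eta] *)

(* Elements are polynomials in [d + d] variables, the first block being eta and
   the second one X, so that the order above has
   eta_1 > ... > eta_d > X_1 > ... > X_d. *)
Definition eta_ (R : realType) (d : nat) (i : 'I_d) : mpoly (d + d) R :=
  mpolyX R (mnm1 (lshift d i)).

Definition X_ (R : realType) (d : nat) (i : 'I_d) : mpoly (d + d) R :=
  mpolyX R (mnm1 (rshift d i)).

Definition eval_X_eta (R : realType) (d : nat) (f : mpoly (d + d) R)
    (x y : 'rV[R]_d) : R := meval (row_mx y x 0) f.

Definition in_eta (R : realType) (d : nat) (f : mpoly d R) : mpoly (d + d) R :=
  comp_mpoly [tuple eta_ R i | i < d] f.

Definition deg_eta (R : realType) (d : nat) (f : mpoly (d + d) R) : nat :=
  (\max_(m <- msupp f) \sum_(i < d) m (lshift d i))%N.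

Definition ideal_I3 (R : realType) (d : nat) : mpoly (d + d) R -> Prop :=
  in_ideal (fun t : 'I_d * 'I_d * 'I_d =>
    (X_ R t.1.1 - eta_ R t.1.1) * (X_ R t.1.2 - eta_ R t.1.2) *
    (X_ R t.2 - eta_ R t.2)).

Definition pairing_X_eta (R : realType) (d : nat) (e : 'I_d -> mpoly d R) :
    mpoly (d + d) R :=
  \sum_(i < d) (X_ R i - eta_ R i) * in_eta (e i).

Definition estimating_equations (R : realType) (d p q : nat)
    (r : 'I_p -> mpoly (d + d) R) (etaE : 'rV[R]_p -> 'rV[R]_d)
    (O : set ('rV[R]_p * 'rV[R]_q)) (H : 'rV[R]_p * 'rV[R]_q -> 'rV[R]_d) :
    Prop :=
  forall u v, O (u, v) -> forall j, eval_X_eta (r j) (H (u, v)) (etaE u) = 0.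

(* Main.v *)
Require Import Defs.
From HB Require Import structures.
From mathcomp Require Import all_boot all_order all_algebra.
From mathcomp Require Import -(notations) mpoly.
From mathcomp Require Import all_classical all_reals all_analysis.
From mathcomp Require Import ring lra zify.
Set Implicit Arguments.
Unset Strict Implicit.
Unset Printing Implicit Defensive.
Import Order.TTheory GRing.Theory Num.Theory numFieldNormedType.Exports.
Local Open Scope classical_set_scope.
Local Open Scope ring_scope.

(** Why the theorem holds.

The cubes [(X_i - eta_i) (X_j - eta_j) (X_k - eta_k)] are invisible to second
derivatives along the diagonal [X = eta].  Since [r_j] differs from
[(X - eta)^T e_j(eta)] by an element of the ideal they generate, the equations
[r_j (X, etaE u) = 0] have the same second-order content as the pairings
themselves, and only the choice of representative modulo the ideal is special:
it has low degree in eta.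

Degree.  As every eta_i is larger than every X_j, the leading monomial of such
a cube is [eta_i eta_j eta_k] ([cubic_lead]).  A Groebner basis therefore
contains, for each triple, an element whose leading monomial divides
[eta_i eta_j eta_k], and a monomial of degree at least 3 in eta is never
reduced ([remainder_deg_eta]).

Efficiency.  Substitute [X = H (u, v)] and [eta = etaE u = H (u, 0)].  All the
differences [X_i - eta_i] vanish at [v = 0], so differentiating the identity
[r_j (H (u, v), etaE u) = 0] twice in v at 0 annihilates the cubic terms and
leaves [\sum_i d^2 H_i / dv_k dv_l * e_ji (etaE u) = 0]
([estimating_curve_second_derivative]).  Write B for the Jacobian matrix of
[etaE] and G for the Fisher metric in eta.  G is the Jacobian matrix of the
inverse map [th] ([diff_natural_parameter]), so [d th / du_a] is the a-th row
of [B G] ([derive_natural_parameter]); the rows of [B G] lie in the Euclidean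
complement of the G-complement of the rows of B, which the vectors [e_j] span
([mulmx_sub_orthomx]).  Hence the sums which define second-order efficiency
are combinations of sums that vanish.

Existence.  Let E be the matrix with rows [e_j (etaE u0)].  At a point of the
diagonal the differential of the map [(X, eta) |-> (r_j (X, eta))_j] is
[(h, k) |-> (h - k) E^T] ([diff_estimating_map]), and [B E^T] is invertible
because [B G = M E] with G positive definite ([pairing_unit]).  The implicit
function theorem ([implicit_function], from a contraction argument) is then
used twice ([estimator_exists]).  Fixing u, it solves the equations along a
complement of the kernel of [E^T], which gives the point with coordinates
[(u, v)]; fixing X, it solves them for u, which gives the estimate and shows
that [(u, v)] are coordinates: each of the two maps is smooth, and uniqueness
of the implicit solutions makes them inverse to each other. *)

(** * Differentials and their remainder estimates *)

Section Differentials.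
Context {R : realType}.
Implicit Types V W Z : normedModType R.

(** Frechet differentiability as an inequality, so that later proofs combine
    estimates rather than little-o terms. *)
Lemma differentiable_le V W (f : V -> W) (L : {linear V -> W}) x :
  continuous L ->
  (forall e, 0 < e ->
     \forall h \near 0, `|f (h + x) - f x - L h| <= e * `|h|) ->
  differentiable f x /\ 'd f x = L :> (V -> W).
Proof.
move=> Lc fL.
have fo : f \o shift x = cst (f x) + L +o_ 0 id.
  apply/eqaddoP => e e0; have := fL e e0; apply: filterS => h /=.
  by rewrite -[(_ - _) h]/(f (h + x) - (f x + L h)) opprD addrA.
have dfL := diff_unique Lc fo; split => //.
by apply/diff_locallyP; rewrite dfL.
Qed.

Lemma differentiableP_le V W (f : V -> W) x : differentiable f x ->
  forall e, 0 < e ->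
     \forall h \near 0, `|f (h + x) - f x - 'd f x h| <= e * `|h|.
Proof.
move=> /diff_locally /eqaddoP fo e e0; have := fo e e0; apply: filterS => h.
by rewrite -[(_ - _) h]/(f (h + x) - (f x + 'd f x h)) opprD addrA.
Qed.

Lemma diff_near_eq V W (f g : V -> W) x : {near x, f =1 g} ->
  differentiable f x -> differentiable g x /\ 'd g x = 'd f x :> (V -> W).
Proof.
move=> fg df.
have [] // := @differentiable_le V W g ('d f x) x; first exact: diff_continuous.
move=> e e0; have := differentiableP_le df e0.
have : \forall h \near (0 : V), f (h + x) = g (h + x).
  by move: fg; rewrite (near_shift 0) subr0.
rewrite (nbhs_singleton fg) => Hn.
by apply: filterS2 Hn => h ->.
Qed.

End Differentials.

(** * Spaces with finitely many coordinates *)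

Section FiniteCoordinates.
Context {R : realType}.

(** Stated by a finite family and continuous coordinate functions rather than
    by an isomorphism with row vectors: products of such spaces are then again
    of this kind with no reindexing of the maps defined on them. *)
Definition finite_coord (V : normedModType R) : Prop :=
  exists (n : nat) (b : 'I_n -> V) (c : 'I_n -> {linear V -> R}),
    (forall i, continuous (c i)) /\ forall v, v = \sum_i c i v *: b i.

Lemma finite_coord_continuous (V W : normedModType R) (L : {linear V -> W}) :
  finite_coord V -> continuous L.
Proof.
move=> [n [b [c [cc bc]]]].
have -> : (L : V -> W) = \sum_i (fun v => c i v *: L (b i)).
  apply/funext => v; rewrite [in LHS](bc v) linear_sum fct_sumE.
  by apply: eq_bigr => i _; rewrite linearZ.
elim/big_ind: _ => [x|f g cf cg x|i _ x]; first exact: cst_continuous.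
  exact: continuousD (cf x) (cg x).
exact: (continuousZr_tmp (cc i x)).
Qed.

Lemma coord_linear (n : nat) (i : 'I_n) :
  exists L : {linear 'rV[R]_n -> R}, continuous L /\ forall v, L v = v 0 i.
Proof.
have lin : linear (fun v : 'rV[R]_n => v 0 i : R) by move=> a u v; rewrite !mxE.
pose LM := GRing.isLinear.Build _ _ _ _ _ lin.
pose L : {linear 'rV[R]_n -> R} := HB.pack (fun v : 'rV[R]_n => v 0 i : R) LM.
by exists L; split => //; exact: coord_continuous.
Qed.

Lemma finite_coord_rV n : finite_coord 'rV[R]_n.
Proof.
exists n, (@evec R n),  (fun i => sval (cid (coord_linear i))); split.
  by move=> i; case: cid => L [].
move=> v; rewrite [LHS]row_sum_delta; apply: eq_bigr => i _.
by case: cid => L [] /= _ ->.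
Qed.

Lemma finite_coord_pair (V W : normedModType R) :
  finite_coord V -> finite_coord W -> finite_coord (V * W)%type.
Proof.
move=> [n [b [c [cc bc]]]] [n' [b' [c' [cc' bc']]]].
pose B (i : 'I_(n + n')) : (V * W)%type :=
  match fintype.split i with inl j => (b j, 0) | inr j => (0, b' j) end.
have CP (i : 'I_(n + n')) : exists L : {linear (V * W)%type -> R}, continuous L /\
    forall x, L x = match fintype.split i with inl j => c j x.1 | inr j => c' j x.2 end.
  case: (fintype.split i) => j.
    exists (c j \o fst); split => // x.
    by apply: continuous_comp; [exact: cvg_fst|exact: cc].
  exists (c' j \o snd); split => // x.
  by apply: continuous_comp; [exact: cvg_snd|exact: cc'].
exists (n + n')%N, B, (fun i => sval (cid (CP i))); split.
  by move=> i; case: cid => L [].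
move=> [v w]; rewrite big_split_ord /=.
under eq_bigr => i _.
  case: cid => L [] /= _ ->; rewrite /B (unsplitK (inl i)); over.
under [X in _ = _ + X]eq_bigr => i _.
  case: cid => L [] /= _ ->; rewrite /B (unsplitK (inr i)); over.
rewrite /=.
have sum1 m (f : 'I_m -> (V * W)%type) :
   \sum_i f i = (\sum_i (f i).1, \sum_i (f i).2).
  by elim/big_ind3: _ => // [a x x' a' y y' -> ->|i _] //; case: (f i).
rewrite !sum1 /=; congr (_, _) => /=.
  by rewrite [X in _ = _ + X]big1 ?addr0 // => i _; rewrite scaler0.
by rewrite [X in _ = X + _]big1 ?add0r // => i _; rewrite scaler0.
Qed.

End FiniteCoordinates.

(** * Calculus of maps of class C^k *)

Section SmoothCalculus.
Context {R : realType}.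
Implicit Types V W Z : normedModType R.

Lemma scale_bilinear W : bilinear_for ( *:%R) ( *:%R) (@GRing.scale R W).
Proof.
split=> [u'|u] a x y /=.
- by rewrite scalerDl scalerA.
- by rewrite scalerDr !scalerA mulrC.
Qed.

(** The one product rule behind all the others: scaling covers both products
    of real functions and combinations of vectors with variable coefficients. *)
Lemma diff_scale V W (f : V -> R) (g : V -> W) x :
  differentiable f x -> differentiable g x ->
  differentiable (fun y => f y *: g y) x /\
  'd (fun y => f y *: g y) x = (fun v => 'd f x v *: g x + f x *: 'd g x v)
    :> (V -> W).
Proof.
move=> df dg.
pose M := bilinear_isBilinear.Build R R W W _ _ (@GRing.scale R W) (scale_bilinear W).
pose B : {bilinear R -> W -> W} := HB.pack (@GRing.scale R W) M.
have Bc : continuous (fun p : R * W => B p.1 p.2) by exact: scale_continuous.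
have dB p := @differentiable_bilin _ _ _ _ B p Bc.
have dp := differentiable_pair df dg.
have -> : (fun y => f y *: g y) =
    (fun p : R * W => B p.1 p.2) \o (fun y => (f y, g y)) by [].
split; first exact: differentiable_comp.
rewrite diff_comp // (diff_bilin _ Bc) (diff_pair df dg).
by apply/funext => v /=; rewrite addrC.
Qed.

Lemma Ck_continuous k V W (U : set V) (f : V -> W) :
  Ck k U f -> forall x, U x -> {for x, continuous f}.
Proof.
by case: k => [//|k] [df _] x Ux; exact/differentiable_continuous/df.
Qed.

Lemma CkW k V W (U : set V) (f : V -> W) : Ck k.+1 U f -> Ck k U f.
Proof.
elim: k f => [|k IH] f; first by move=> H x Ux; exact: Ck_continuous H x Ux.
by move=> [df cf]; split => // v; exact/IH/cf.
Qed.

Lemma Ck_sub k V W (U U' : set V) (f : V -> W) :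
  U' `<=` U -> Ck k U f -> Ck k U' f.
Proof.
move=> sU; elim: k f => [|k IH] f /=; first by move=> cf x /sU; exact: cf.
by move=> [df cf]; split => [x /sU|v]; [exact: df|exact/IH/cf].
Qed.

(** [Ck k U f] mentions values and differentials of [f] at the points of [U]
    only, but a differential sees a neighbourhood: this is where [U] has to be
    open. *)
Lemma Ck_eq_in k V W (U : set V) (f g : V -> W) : open U ->
  (forall x, U x -> f x = g x) -> Ck k U f -> Ck k U g.
Proof.
move=> oU; elim: k f g => [|k IH] f g fg /=.
  move=> cf x Ux; change (g @ x --> g x); rewrite -(fg _ Ux).
  apply: cvg_trans (cf x Ux); apply: near_eq_cvg.
  by apply: filterS (open_nbhs_nbhs (conj oU Ux)) => y /fg.
have nfg x : U x -> {near x, f =1 g}.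
  by move=> Ux; apply: filterS (open_nbhs_nbhs (conj oU Ux)) => y /fg.
move=> [df cf]; split => [x Ux|v].
  by have [] := diff_near_eq (nfg x Ux) (df x Ux).
apply: (IH _ _ _ (cf v)) => x Ux.
by have [_ ->] := diff_near_eq (nfg x Ux) (df x Ux).
Qed.

Lemma Ck_cst k V W (U : set V) (a : W) : Ck k U (fun _ => a).
Proof.
elim: k a => [|k IH] a /=; first by move=> x _; exact: cst_continuous.
split=> [x _|v]; first exact: differentiable_cst.
have -> : (fun x : V => 'd (fun=> a) x v) = (fun _ => 0).
  by apply/funext => x; rewrite (diff_cst a x).
exact: IH.
Qed.

Lemma Ck_add k V W (U : set V) (f g : V -> W) : open U ->
  Ck k U f -> Ck k U g -> Ck k U (fun x => f x + g x).
Proof.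
move=> oU; elim: k f g => [|k IH] f g /=.
  by move=> cf cg x Ux; exact: continuousD (cf x Ux) (cg x Ux).
move=> [df cf] [dg cg]; split=> [x Ux|v].
  exact: differentiableD (df x Ux) (dg x Ux).
apply: (Ck_eq_in oU _ (IH _ _ (cf v) (cg v))) => x Ux.
by rewrite -[LHS]/(('d f x \+ 'd g x) v) -(diffD (df x Ux) (dg x Ux)).
Qed.

Lemma Ck_sum k V W (U : set V) I (r : seq I) (P : pred I) (f : I -> V -> W) :
  open U -> (forall i, P i -> Ck k U (f i)) ->
  Ck k U (fun x => \sum_(i <- r | P i) f i x).
Proof.
move=> oU Cf; elim: r => [|i r IH].
  apply: (Ck_eq_in oU _ (Ck_cst k U 0)) => x _; by rewrite big_nil.
have [Pi|nPi] := boolP (P i).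
  apply: (Ck_eq_in oU _ (Ck_add oU (Cf i Pi) IH)) => x _.
  by rewrite big_cons Pi.
by apply: (Ck_eq_in oU _ IH) => x _; rewrite big_cons (negPf nPi).
Qed.

Lemma Ck_scale k V W (U : set V) (f : V -> R) (g : V -> W) : open U ->
  Ck k U f -> Ck k U g -> Ck k U (fun x => f x *: g x).
Proof.
move=> oU; elim: k f g => [|k IH] f g.
  move=> /= cf cg x Ux.
  by apply: (@cvgZ _ _ _ (nbhs x)); [exact: cf|exact: cg].
move=> Hf Hg; have [[df cf] [dg cg]] := (Hf, Hg); split=> [x Ux|v].
  by have [] := diff_scale (df x Ux) (dg x Ux).
apply: (Ck_eq_in oU _
  (Ck_add oU (IH _ _ (cf v) (CkW Hg)) (IH _ _ (CkW Hf) (cg v)))) => x Ux.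
by have [_ ->] := diff_scale (df x Ux) (dg x Ux).
Qed.

Lemma Ck_mul k V (U : set V) (f g : V -> R) : open U ->
  Ck k U f -> Ck k U g -> Ck k U (fun x => f x * g x).
Proof. exact: (@Ck_scale k V R). Qed.

Lemma Ck_prod k V (U : set V) I (r : seq I) (f : I -> V -> R) :
  open U -> (forall i, Ck k U (f i)) ->
  Ck k U (fun x => \prod_(i <- r) f i x).
Proof.
move=> oU Cf; elim: r => [|i r IH].
  by apply: (Ck_eq_in oU _ (@Ck_cst k V R U 1)) => x _; rewrite big_nil.
by apply: (Ck_eq_in oU _ (Ck_mul oU (Cf i) IH)) => x _; rewrite big_cons.
Qed.

Lemma Ck_exp k V (U : set V) (f : V -> R) n :
  open U -> Ck k U f -> Ck k U (fun x => f x ^+ n).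
Proof.
move=> oU Cf; elim: n => [|n IH].
  by apply: (Ck_eq_in oU _ (@Ck_cst k V R U 1)) => x _; rewrite expr0.
by apply: (Ck_eq_in oU _ (Ck_mul oU Cf IH)) => x _; rewrite exprS.
Qed.

Lemma Ck_inv k V (U : set V) (f : V -> R) : open U ->
  (forall x, U x -> f x != 0) -> Ck k U f -> Ck k U (fun x => (f x)^-1).
Proof.
move=> oU f0; elim: k f f0 => [|k IH] f f0.
  by move=> /= cf x Ux; apply: (@cvgV _ _ (nbhs x)); [exact: f0|exact: cf].
move=> Hf; have [df cf] := Hf; split=> [x Ux|v].
  by apply: differentiableV; [exact: df|exact: f0].
have Cfi := IH f f0 (CkW Hf).
apply: (Ck_eq_in oU _ (Ck_mul oU (@Ck_cst k V R U (-1))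
  (Ck_mul oU (Ck_mul oU Cfi Cfi) (cf v)))) => x Ux.
have -> : 'd (fun y => (f y)^-1) x v = - (f x) ^- 2 * 'd f x v.
  by rewrite (diffV (df x Ux) (f0 x Ux)).
by rewrite mulN1r mulNr -invfM expr2.
Qed.

Lemma Ck_comp_linear k V W Z (U : set V) (f : V -> W) (L : {linear W -> Z}) :
  open U -> continuous L -> Ck k U f -> Ck k U (fun x => L (f x)).
Proof.
move=> oU cL; elim: k f => [|k IH] f.
  by move=> /= cf x Ux; apply: continuous_comp; [exact: cf|exact: cL].
move=> [df cf]; have dL y := linear_differentiable y cL.
split=> [x Ux|v]; first exact: differentiable_comp (df x Ux) (dL _).
apply: (Ck_eq_in oU _ (IH _ (cf v))) => x Ux.
by rewrite (diff_comp (df x Ux) (dL _)) /= (diff_lin _ cL).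
Qed.

Lemma Ck_linear k V W (U : set V) (L : {linear V -> W}) :
  open U -> continuous L -> Ck k U L.
Proof.
move=> oU cL; apply: (@Ck_comp_linear k V V W U id L) => //.
case: k => [|k]; first by move=> x _.
split=> [x _|v]; first by apply: (@linear_differentiable _ _ _ idfun) => y.
apply: (Ck_eq_in oU _ (Ck_cst k U v)) => x _.
by rewrite (@diff_lin _ _ _ idfun) // => y.
Qed.

Lemma Ck_pair k V W Z (U : set V) (f : V -> W) (g : V -> Z) : open U ->
  Ck k U f -> Ck k U g -> Ck k U (fun x => (f x, g x)).
Proof.
move=> oU; elim: k f g => [|k IH] f g.
  move=> /= cf cg x Ux; exact: cvg_pair (cf x Ux) (cg x Ux).
move=> [df cf] [dg cg]; split=> [x Ux|v].
  exact: differentiable_pair (df x Ux) (dg x Ux).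
apply: (Ck_eq_in oU _ (IH _ _ (cf v) (cg v))) => x Ux.
by rewrite (diff_pair (df x Ux) (dg x Ux)).
Qed.

Lemma Ck_coord k V n (U : set V) (f : V -> 'rV[R]_n) i : open U ->
  Ck k U f -> Ck k U (fun x => f x 0 i).
Proof.
have [L [cL eL]] := @coord_linear R n i => oU Cf.
apply: (@Ck_eq_in k V R U (fun x => L (f x))) => //; exact: Ck_comp_linear.
Qed.

Lemma Ck_row k V n (U : set V) (f : V -> 'rV[R]_n) : open U ->
  (forall i, Ck k U (fun x => f x 0 i)) -> Ck k U f.
Proof.
move=> oU Cf.
apply: (@Ck_eq_in k V _ U (fun x => \sum_i f x 0 i *: evec R i)) => //.
  by move=> x _; rewrite -row_sum_delta.
by apply: Ck_sum => // i _; apply: Ck_scale => //; exact: Ck_cst.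
Qed.

(** The recursion of [Ck] differentiates along fixed directions, whereas the
    chain rule gives ['d g (f x)] in the direction ['d f x v], which moves with
    [x].  Expanding that direction over a finite basis of the middle space
    returns to fixed directions. *)
Lemma Ck_comp k V W Z (U : set V) (U' : set W) (f : V -> W) (g : W -> Z) :
  open U -> finite_coord W -> (forall x, U x -> U' (f x)) ->
  Ck k U f -> Ck k U' g -> Ck k U (fun x => g (f x)).
Proof.
move=> oU [n [b [c [cc bc]]]] fU; elim: k f g fU => [|k IH] f g fU.
  move=> /= cf cg x Ux; apply: continuous_comp; first exact: cf.
  by apply: cg; exact: fU.
move=> Cf [dg cg]; have [df cf] := Cf; split=> [x Ux|v].
  exact: differentiable_comp (df x Ux) (dg _ (fU x Ux)).
apply: (@Ck_eq_in k V _ U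
  (fun x => \sum_i c i ('d f x v) *: 'd g (f x) (b i))) => //.
  move=> x Ux; rewrite (diff_comp (df x Ux) (dg _ (fU x Ux))) /=.
  rewrite [in RHS](bc ('d f x v)) linear_sum.
  by apply: eq_bigr => i _; rewrite linearZ.
apply: Ck_sum => // i _; apply: Ck_scale => //.
  by apply: Ck_comp_linear => //; exact: cf.
exact: (IH f (fun y => 'd g y (b i)) fU (CkW Cf) (cg _)).
Qed.

Lemma Ck_meval k V n (U : set V) (f : V -> 'rV[R]_n) (P : mpoly n R) :
  open U -> Ck k U f -> Ck k U (fun x => meval (f x 0) P).
Proof.
move=> oU Cf.
apply: (@Ck_eq_in k V _ U
  (fun x => \sum_(m <- msupp P) mcoeff m P * \prod_i f x 0 i ^+ m i)) => //.
apply: Ck_sum => // m _; apply: Ck_mul => //; first exact: Ck_cst.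
by apply: Ck_prod => // i; apply: Ck_exp => //; exact: Ck_coord.
Qed.

Lemma Ck_det k V n (U : set V) (A : V -> 'M[R]_n) : open U ->
  (forall i j, Ck k U (fun x => A x i j)) -> Ck k U (fun x => \det (A x)).
Proof.
move=> oU CA; rewrite /determinant.
apply: Ck_sum => // s _; apply: Ck_mul => //; first exact: Ck_cst.
exact: Ck_prod.
Qed.

(** Cramer's rule: the entries of the inverse are cofactors, polynomial in the
    entries, divided by a determinant that does not vanish. *)
Lemma Ck_invmx k V n (U : set V) (A : V -> 'M[R]_n) : open U ->
  (forall x, U x -> A x \in unitmx) ->
  (forall i j, Ck k U (fun x => A x i j)) ->
  forall i j, Ck k U (fun x => invmx (A x) i j).
Proof.
move=> oU Au CA i j.
apply: (@Ck_eq_in k V _ U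
  (fun x => (\det (A x))^-1 * ((-1) ^+ (j + i) * \det (row' j (col' i (A x)))))) => //.
  by move=> x Ux; rewrite /invmx Au // !mxE.
apply: Ck_mul => //.
  apply: Ck_inv => //; last exact: Ck_det.
  by move=> x /Au; rewrite unitmxE unitfE.
apply: Ck_mul => //; first exact: Ck_cst.
apply: Ck_det => // i' j'.
by apply: (Ck_eq_in oU _ (CA (lift j i') (lift i j'))) => x _; rewrite !mxE.
Qed.

End SmoothCalculus.

(** * The sup norm on row vectors and the mean value inequality *)

Section RowNorm.
Context {R : realType}.

Lemma norm_coord_le n (h : 'rV[R]_n) i : `|h 0 i| <= `|h|.
Proof.
rewrite [leRHS]/Num.Def.normr/= mx_normrE.
exact: (le_bigmax _ (fun ij : 'I_1 * 'I_n => `|h ij.1 ij.2|) (0, i)).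
Qed.

Lemma norm_row_le n (h : 'rV[R]_n) M : 0 <= M ->
  (forall i, `|h 0 i| <= M) -> `|h| <= M.
Proof.
move=> M0 hM; rewrite [leLHS]/Num.Def.normr/= mx_normrE.
by apply: bigmax_le => // -[i j] _; rewrite ord1.
Qed.

Lemma linear_norm_le n (W : normedModType R) (L : {linear 'rV[R]_n -> W}) (M : R) :
  (forall i, `|L (evec R i)| <= M) -> forall h, `|L h| <= n%:R * M * `|h|.
Proof.
move=> LM h; rewrite [h in L h]row_sum_delta linear_sum.
rewrite (le_trans (ler_norm_sum _ _ _)) //.
rewrite (@le_trans _ _ (\sum_(i < n) M * `|h|)) //; last first.
  by rewrite sumr_const card_ord -[leLHS]mulr_natl mulrA.
apply: ler_sum => i _; rewrite linearZ normrZ mulrC.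
by rewrite ler_pM // ?norm_coord_le //; exact: LM.
Qed.

(** For the sup norm, the inequality follows from the scalar mean value theorem
    applied to each coordinate on the segment. *)
Lemma mean_value_le (V : normedModType R) n (f : V -> 'rV[R]_n) (x y : V) (M : R) :
  (forall t : R, 0 <= t <= 1 -> differentiable f (x + t *: (y - x))) ->
  (forall t : R, 0 <= t <= 1 -> `|'d f (x + t *: (y - x)) (y - x)| <= M) ->
  `|f y - f x| <= M.
Proof.
move=> df dM.
have M0 : 0 <= M by apply: le_trans (dM 0 _); rewrite ?lexx ?ler01.
apply: norm_row_le => // i.
pose c (t : R) := x + t *: (y - x).
have dc t : is_diff (t : R) c (fun s => s *: (y - x)).
  have -> : c = cst x + (fun t => t *: (y - x)) by [].
  apply: (is_diff_eq (is_diffD (is_diff_cst x t) (is_diff_scalel t (y - x)))).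
  by rewrite add0r.
have [L [cL eL]] := @coord_linear R n i.
have dL z := linear_differentiable z cL.
pose phi (t : R) : R := L (f (c t)).
have dphi (t : R) : 0 <= t <= 1 -> differentiable phi t /\
    'd phi t 1 = ('d f (c t) (y - x)) 0 i.
  move=> t01; have dct : differentiable c t by exact: ex_diff.
  have dfc := differentiable_comp dct (df t t01).
  split; first exact: differentiable_comp dfc (dL _).
  rewrite (diff_comp dfc (dL _)) /= (diff_comp dct (df t t01)) /=.
  by rewrite (diff_lin _ cL) eL (@diff_val _ _ _ _ _ _ _ (dc t)) scale1r.
have [||t t01] := @MVT_segment R phi (fun t => ('d f (c t) (y - x)) 0 i) 0 1 ler01.
- move=> t; rewrite in_itv /= => /andP[t0 t1].
  have [|d1 d2] := dphi t; first by rewrite !ltW.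
  by apply: DeriveDef; [exact: diff_derivable|rewrite deriveE].
- apply/continuous_within_itvP; first exact: ltr01.
  split; [move=> t; rewrite in_itv /= => /andP[t0 t1]| |].
  + by apply: differentiable_continuous; apply: (dphi t _).1; rewrite !ltW.
  + apply: cvg_at_right_filter; apply: differentiable_continuous.
    by apply: (dphi 0 _).1; rewrite lexx ler01.
  + apply: cvg_at_left_filter; apply: differentiable_continuous.
    by apply: (dphi 1 _).1; rewrite lexx ler01.
rewrite subr0 mulr1 /phi !eL /c scale1r scale0r addr0 [x + _]addrC subrK => E.
rewrite !mxE E (le_trans (norm_coord_le _ _)) // dM //.
Qed.

End RowNorm.

(** * The implicit function theorem: solution by contraction *)

Section ImplicitFunction.
Context {R : realType} (V : normedModType R) (n : nat).
Implicit Type F : (V * 'rV[R]_n)%type -> 'rV[R]_n.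

(** The quantitative hypothesis of the contraction argument: where the partial
    differential of [F] in its second variable is at distance at most [1/2]
    from the identity, [y |-> y - F (x, y)] is a [1/2]-contraction whose fixed
    points are the zeros of [F (x, _)]. *)
Definition near_id_on F (A : set V) (b : 'rV[R]_n) (rho : R) :=
  forall x y, A x -> `|y - b| < rho ->
    differentiable F (x, y) /\
    forall h : 'rV[R]_n, `|'d F (x, y) (0, h) - h| <= 2^-1 * `|h|.

(** Continuity of the finitely many columns ['d F z (0, e_i)] is enough to
    control the operator norm of the partial differential. *)
Lemma near_id_exists F (S : set (V * 'rV[R]_n)%type) a b :
  open S -> S (a, b) -> Ck 1 S F -> (forall h, 'd F (a, b) (0, h) = h) ->
  exists (A : set V) (rho : R), [/\ open A, A a, 0 < rho,
    near_id_on F A b rho & forall x y, A x -> `|y - b| < rho -> S (x, y)].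
Proof.
move=> oS Sab [dF cF] Fid.
(* [n] columns, each within [e] of its target, give an operator norm below
   [n * e <= 1/2]; [n.+1] keeps [e] meaningful when [n = 0]. *)
pose e : R := (2 * n.+1%:R)^-1.
have e0 : 0 < e by rewrite invr_gt0 mulr_gt0.
have : \forall z \near (a, b), S z /\
    forall i : 'I_n, `|'d F z (0, evec R i) - evec R i| < e.
  near=> z; split; first by near: z; exact: open_nbhs_nbhs.
  near: z; apply: filter_forall => i.
  have := cF (0, evec R i) (a, b) Sab.
  move/cvgrPdist_lt => /(_ e e0); apply: filterS => z.
  by rewrite distrC => zlt; rewrite -[X in `|_ - X| < _](Fid (evec R i)).
move=> [[P Q] /= [Pa Qb] PQ].
have [rho /= rho0 Qrho] := (nbhs_ballP _ _).1 Qb.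
have inPQ x y : P° x -> `|y - b| < rho -> (P `*` Q) (x, y).
  move=> /interior_subset Px yb; split => //=.
  by apply: Qrho; rewrite -ball_normE /= distrC.
exists P°, rho; split => //; first exact: open_interior.
- move=> x y Px yb; have [Sxy dFe] := PQ _ (inPQ x y Px yb).
  split; first exact: dF.
  have lin : linear (fun h : 'rV[R]_n => 'd F (x, y) (0, h) - h).
    move=> c h k; rewrite scalerBr addrACA -opprD; congr (_ - _).
    rewrite -linearZ -linearD /=; congr ('d F _ (_, _)).
    by rewrite /= scaler0 addr0.
  pose LM := GRing.isLinear.Build _ _ _ _ _ lin.
  pose L : {linear 'rV[R]_n -> 'rV[R]_n} :=
    HB.pack (fun h : 'rV[R]_n => 'd F (x, y) (0, h) - h) LM.
  move=> h; have := @linear_norm_le R n _ L e (fun i => ltW (dFe i)) h.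
  move=> /le_trans; apply; rewrite ler_wpM2r //.
  rewrite /e invfM mulrCA ler_piMr ?invr_ge0 //.
  by rewrite ler_pdivrMr // mul1r ler_nat.
- by move=> x y Px yb; have [] := PQ _ (inPQ x y Px yb).
Unshelve. all: by end_near. Qed.

Lemma near_id_lipschitz F A b rho : near_id_on F A b rho ->
  forall x y y', A x -> `|y - b| < rho -> `|y' - b| < rho ->
  `|(y - F (x, y)) - (y' - F (x, y'))| <= 2^-1 * `|y - y'|.
Proof.
move=> nF x y y' Ax yb yb'.
pose f (z : 'rV[R]_n) := z - F (x, z).
rewrite -/(f y) -/(f y').
have df z : `|z - b| < rho -> differentiable f z /\
    forall h, 'd f z h = h - 'd F (x, z) (0, h).
  move=> zb; have [dF _] := nF x z Ax zb.
  have dp : differentiable (fun z : 'rV[R]_n => (x, z)) z.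
    exact: differentiable_pair.
  have dFp := differentiable_comp dp dF.
  have did : differentiable (@id 'rV[R]_n) z by [].
  split; first exact: differentiableB did dFp.
  have Edf : 'd f z = 'd id z \- 'd (F \o (fun z => (x, z))) z
    :> ('rV[R]_n -> 'rV[R]_n) := diffB did dFp.
  have Eid : 'd id z = id :> ('rV[R]_n -> 'rV[R]_n).
    by rewrite (@diff_lin R _ _ idfun) // => y0.
  have EF : 'd (F \o (fun z => (x, z))) z = 'd F (x, z) \o 'd (fun z => (x, z)) z
    :> ('rV[R]_n -> 'rV[R]_n) := diff_comp dp dF.
  have Ep : 'd (fun z => (x, z)) z = (fun h => (0, h))
    :> ('rV[R]_n -> (V * 'rV[R]_n)%type).
    have -> : 'd (fun z => (x, z)) z = (fun h => ('d (cst x) z h, 'd id z h))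
      :> ('rV[R]_n -> (V * 'rV[R]_n)%type)
      := diff_pair (differentiable_cst x z) did.
    by rewrite Eid diff_cst.
  move=> h; apply: etrans (congr1 (fun u => u h) Edf) _.
  congr (_ - _); first exact: (congr1 (fun u => u h) Eid).
  apply: etrans (congr1 (fun u => u h) EF) _.
  exact: (congr1 (fun u => 'd F (x, z) (u h)) Ep).
have ball_cvx t : 0 <= t <= 1 -> `|y' + t *: (y - y') - b| < rho.
  move=> /andP[t0 t1].
  have -> : y' + t *: (y - y') - b = (1 - t) *: (y' - b) + t *: (y - b).
    rewrite !scalerBr !scalerBl !scale1r.
    by rewrite opprB addrACA -[in RHS]addrA; apply/rowP => i; rewrite !mxE; ring.
  rewrite (le_lt_trans (ler_normD _ _)) // !normrZ ger0_norm ?subr_ge0 //.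
  rewrite (ger0_norm t0).
  have [->|tn0] := eqVneq t 0; first by rewrite subr0 mul1r mul0r addr0.
  rewrite (@lt_le_trans _ _ ((1 - t) * rho + t * rho)) //; last first.
    by rewrite -mulrDl subrK mul1r.
  rewrite ler_ltD // ?ler_wpM2l ?subr_ge0 ?(ltW yb') //.
  by rewrite ltr_pM2l // lt0r tn0.
apply: (@mean_value_le R _ _ f y' y) => t /ball_cvx tb.
  by have [] := df _ tb.
have [_ ->] := df _ tb; have [_ H] := nF _ _ Ax tb.
by rewrite distrC; exact: H.
Qed.

(** Distance between points is controlled by the distance between their values:
    this gives uniqueness of the solutions and, later, the Lipschitz estimate
    on which their differentiability rests. *)
Lemma near_id_inj F A b rho : near_id_on F A b rho ->
  forall x y y', A x -> `|y - b| < rho -> `|y' - b| < rho ->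
  `|y - y'| <= 2 * `|F (x, y) - F (x, y')|.
Proof.
move=> nF x y y' Ax yb yb'.
have H := near_id_lipschitz nF Ax yb yb'.
set d := F (x, y) - F (x, y').
have : `|y - y'| <= 2^-1 * `|y - y'| + `|d|.
  apply: le_trans (lerD H (lexx _)).
  rewrite (le_trans _ (ler_normD _ _)) // /d.
  by rewrite le_eqVlt; apply/orP; left; apply/eqP; congr (`|_|);
    apply/rowP => i; rewrite !mxE; ring.
move=> H2; lra.
Qed.

(** Banach's fixed point theorem on the closed ball of radius [rho / 2]: from
    [|F (x, b)| < rho / 4] and the contraction by [1/2], that ball is mapped
    into its interior, so that the solution lies in the open ball. *)
Lemma near_id_solution F A a b rho : open A -> A a -> 0 < rho ->
  near_id_on F A b rho -> F (a, b) = 0 ->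
  exists (A' : set V) (g : V -> 'rV[R]_n), [/\ open A', A' a, A' `<=` A
    & forall x, A' x -> `|g x - b| < rho / 2 /\ F (x, g x) = 0].
Proof.
move=> oA Aa rho0 nF Fab.
have bb : `|b - b| < rho by rewrite subrr normr0.
have cFb : {for a, continuous (fun x => F (x, b))}.
  have [dF _] := nF a b Aa bb.
  apply: (@differentiable_continuous R V 'rV[R]_n).
  apply: (@differentiable_comp R V (V * 'rV[R]_n)%type 'rV[R]_n
    (fun x => (x, b)) F).
    exact: differentiable_pair.
  exact: dF.
have : \forall x \near a, A x /\ `|F (x, b)| < rho / 4.
  near=> x; split; first by near: x; exact: open_nbhs_nbhs.
  near: x; move/cvgrPdist_lt: cFb => /(_ (rho / 4)).
  rewrite Fab divr_gt0 // => /(_ isT); apply: filterS => x.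
  by rewrite sub0r normrN.
rewrite -/(nbhs a _) => nP.
pose P := [set x | A x /\ `|F (x, b)| < rho / 4].
have sol x : P x -> exists y, `|y - b| < rho / 2 /\ F (x, y) = 0.
  move=> [Ax Fx].
  pose T (y : 'rV[R]_n) := y - F (x, y).
  pose B := [set y : 'rV[R]_n | `|y - b| <= rho / 2].
  have Bsub y : B y -> `|y - b| < rho.
    by move=> /le_lt_trans; apply; rewrite ltr_pdivrMr // ltr_pMr // ltr1n.
  have lipT y y' : B y -> B y' -> `|T y - T y'| <= 2^-1 * `|y - y'|.
    by move=> By By'; apply: (near_id_lipschitz nF Ax); exact: Bsub.
  have Tb y : B y -> `|T y - b| < rho / 2.
    move=> By; have Bb : B b by rewrite /B /= subrr normr0 divr_ge0 // ltW.
    have H := lipT y b By Bb.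
    have -> : T y - b = (T y - T b) - F (x, b).
      by apply/rowP => i; rewrite /T !mxE; ring.
    rewrite (le_lt_trans (ler_normB _ _)) //.
    move: By Fx H; rewrite /B /=.
    set u := `|T y - T b|; set v := `|y - b|; set w := `|F _|.
    by move=> *; lra.
  have TB : set_fun B B T by move=> y By; exact/ltW/Tb.
  pose TM := isFun.Build _ _ B B T TB.
  pose f : {fun B >-> B} := HB.pack T TM.
  (* The fixed point theorem asks for the join of the complete and the normed
     structures of row vectors. *)
  pose X : completeNormedModType R := HB.pack 'rV[R]_n.
  have [|||y By yT] := @banach_fixed_point R X B f.
  - exists (2^-1)%:nng; split; first by rewrite /= invf_lt1 // ltr1n.
    by move=> [y y'] [/= By By']; exact: lipT.
  - have -> : B = (fun y : 'rV[R]_n => `|y - b|) @^-1` [set t | t <= rho / 2] by [].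
    apply: closed_comp; last exact: closed_le.
    move=> y _; apply: continuous_comp; last exact: norm_continuous.
    by apply: continuousB => //; exact: cst_continuous.
  - by exists b; rewrite /B /= subrr normr0 divr_ge0 // ltW.
  exists y; split; first by rewrite [y]yT; exact: Tb.
  have : y = T y := yT.
  rewrite /T => /eqP; rewrite -subr_eq0 opprB addrC subrK => /eqP.
  exact.
exists P°, (fun x => xget 0 [set y | `|y - b| < rho / 2 /\ F (x, y) = 0]).
split; [exact: open_interior|exact: nP| |].
  by move=> x /interior_subset [].
move=> x /interior_subset /sol [y Hy].
by case: xgetP => [z -> //|/(_ y)]; contradiction.
Unshelve. all: by end_near. Qed.

Lemma near_id_partial_inj F A b rho x y : near_id_on F A b rho ->
  A x -> `|y - b| < rho -> forall h : 'rV[R]_n, `|h| <= 2 * `|'d F (x, y) (0, h)|.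
Proof.
move=> nF Ax yb h; have [_ /(_ h) H] := nF x y Ax yb.
have : `|h| <= `|'d F (x, y) (0, h) - h| + `|'d F (x, y) (0, h)|.
  rewrite distrC.
  rewrite -[X in X <= _](congr1 Num.norm (subrK ('d F (x, y) (0, h)) h)).
  exact: ler_normD.
move: H; set u := `|_ - h|; set v := `|'d F _ _|; set w := `|h|.
by move=> *; lra.
Qed.

End ImplicitFunction.

(** * The implicit function theorem: smoothness of the solution *)

Section ImplicitSmooth.
Context {R : realType} (V : normedModType R) (n : nat).
Implicit Type F : (V * 'rV[R]_n)%type -> 'rV[R]_n.

Definition partial_mx F (z : (V * 'rV[R]_n)%type) : 'M[R]_n :=
  \matrix_(i, j) ('d F z (0, evec R i)) 0 j.

Lemma mul_partial_mx F z h : 'd F z (0, h) = h *m partial_mx F z.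
Proof.
rewrite [h in LHS]row_sum_delta.
have -> : (0, \sum_i h 0 i *: 'e_i) =
    \sum_i h 0 i *: ((0, evec R i) : (V * 'rV[R]_n)%type).
  elim/big_ind2: _ => // [x x' y y' <- <-|i _]; congr (_, _) => /=.
    by rewrite addr0.
  by rewrite scaler0.
rewrite linear_sum mulmx_sum_row; apply: eq_bigr => i _.
by rewrite linearZ; congr (_ *: _); apply/rowP => j; rewrite !mxE.
Qed.

Lemma partial_mx_unit F A b rho x y : near_id_on F A b rho ->
  A x -> `|y - b| < rho -> partial_mx F (x, y) \in unitmx.
Proof.
move=> nF Ax yb; rewrite -row_free_unit -kermx_eq0.
apply/eqP/row_matrixP => i; rewrite row0.
have := near_id_partial_inj nF Ax yb (row i (kermx (partial_mx F (x, y)))).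
rewrite mul_partial_mx -row_mul mulmx_ker row0 normr0 mulr0 normr_le0.
by move/eqP.
Qed.

(** Let [w] be the increment of [g] for an increment [h] of [x], and [J] the
    partial Jacobian matrix.  As [F] vanishes at both ends, its differential at
    [(h, w)], which is [(w - L h) J] for the expected differential [L], is
    [o(|h| + |w|)], hence [o(|h|)] because [|w|] is at most a multiple of [|h|];
    and [J] is bounded below since it is close to the identity. *)
Lemma implicit_differentiable F A b rho (g : V -> 'rV[R]_n) :
  finite_coord V -> open A -> near_id_on F A b rho ->
  (forall x, A x -> `|g x - b| < rho /\ F (x, g x) = 0) ->
  forall x, A x -> differentiable g x /\
    forall v, 'd g x v = - ('d F (x, g x) (v, 0) *m invmx (partial_mx F (x, g x))).
Proof.
move=> fV oA nF gF x Ax; have [gb Fx] := gF x Ax.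
have [dF _] := nF x (g x) Ax gb.
set J := partial_mx F (x, g x).
have uJ : J \in unitmx := partial_mx_unit nF Ax gb.
have lin : linear (fun v => - ('d F (x, g x) (v, 0) *m invmx J)).
  move=> c u v.
  have -> : (c *: u + v, 0) = c *: (u, 0) + (v, 0) :> (V * 'rV[R]_n)%type.
    by congr (_, _); rewrite /= scaler0 addr0.
  by rewrite linearP mulmxDl -scalemxAl opprD scalerN.
pose LM := GRing.isLinear.Build _ _ _ _ _ lin.
pose L : {linear V -> 'rV[R]_n} :=
  HB.pack (fun v => - ('d F (x, g x) (v, 0) *m invmx J)) LM.
have cL : continuous L by exact: finite_coord_continuous.
suff H : forall e, 0 < e ->
    \forall h \near 0, `|g (h + x) - g x - L h| <= e * `|h|.
  have [dg Edg] := differentiable_le cL H.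
  by split => // v; rewrite Edg.
have dFx : differentiable (fun x' => F (x', g x)) x.
  apply: (@differentiable_comp R V (V * 'rV[R]_n)%type 'rV[R]_n
    (fun x' => (x', g x)) F).
    exact: differentiable_pair.
  exact: dF.
have [K K0 dK] := linear_lipschitz (diff_continuous dFx).
have nA : \forall h \near (0 : V), A (h + x).
  have : \forall y \near x, A y by exact: open_nbhs_nbhs.
  by rewrite (near_shift 0) subr0.
pose C := 2 * (1 + K).
have C0 : 0 < C by rewrite mulr_gt0 // addr_gt0.
have gC : \forall h \near (0 : V), `|g (h + x) - g x| <= C * `|h|.
  near=> h.
  have Ahx : A (h + x) by near: h.
  have [gb' Fx'] := gF _ Ahx.
  rewrite (le_trans (near_id_inj nF Ahx gb' gb)) // Fx' sub0r normrN.
  rewrite /C -mulrA ler_pM2l // mulrDl.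
  have : `|F (h + x, g x) - F (x, g x) - 'd (fun x' => F (x', g x)) x h| <= 1 * `|h|.
    by near: h; apply: (differentiableP_le dFx).
  rewrite Fx subr0 => le1.
  rewrite -[X in `|X|](subrK ('d (fun x' => F (x', g x)) x h)).
  by rewrite (le_trans (ler_normD _ _)) // lerD.
move=> e e0.
pose e' := e / (2 * (1 + C)).
have e'0 : 0 < e' by rewrite divr_gt0 // mulr_gt0 // addr_gt0.
have [d /= d0 Hd] := (nbhs_ballP _ _).1 (differentiableP_le dF e'0).
near=> h.
have Ahx : A (h + x) by near: h.
have gh : `|g (h + x) - g x| <= C * `|h| by near: h.
have hd : (1 + C) * `|h| < d.
  rewrite mulrC -ltr_pdivlMr ?addr_gt0 //.
  near: h; apply: nbhs0_lt; rewrite divr_gt0 // addr_gt0 //.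
set w := g (h + x) - g x in gh *.
have hle : `|h| <= (1 + C) * `|h| by rewrite mulrDl mul1r lerDl mulr_ge0 // ltW.
have wle : `|w| <= (1 + C) * `|h| by rewrite mulrDl mul1r (le_trans gh) // lerDr.
have /Hd /= : ball 0 d ((h, w) : (V * 'rV[R]_n)%type).
  by split; rewrite -ball_normE /= sub0r normrN (le_lt_trans _ hd).
have -> : (h, w) + (x, g x) = (h + x, g (h + x)) :> (V * 'rV[R]_n)%type.
  by congr (_, _); rewrite /= /w subrK.
rewrite Fx (gF _ Ahx).2 subrr sub0r normrN => le2.
have zJ : 'd F (x, g x) (h, w) = (w - L h) *m J.
  have -> : (h, w) = (h, 0) + (0, w) :> (V * 'rV[R]_n)%type.
    by congr (_, _); rewrite /= ?addr0 ?add0r.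
  by rewrite linearD mul_partial_mx -/J /L /= opprK [RHS]mulmxDl mulmxKV // addrC.
rewrite (le_trans (near_id_partial_inj nF Ax gb _)) //.
rewrite mul_partial_mx -/J -zJ.
have nhw : `|((h, w) : (V * 'rV[R]_n)%type)| <= (1 + C) * `|h|.
  by rewrite ge_max hle wle.
have le3 := le_trans le2 (ler_wpM2l (ltW e'0) nhw).
rewrite (le_trans (ler_wpM2l _ le3)) // /e'.
have -> // : 2 * (e / (2 * (1 + C)) * ((1 + C) * `|h|)) = e * `|h|.
by field; rewrite gt_eqF // addr_gt0.
Unshelve. all: by end_near. Qed.

(** Bootstrap: the formula for the differential of [g] involves [g] itself, so
    if [g] is of class C^k then so is its differential. *)
Lemma implicit_smooth F S A b rho (g : V -> 'rV[R]_n) :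
  finite_coord V -> open A -> near_id_on F A b rho ->
  smooth_on S F -> (forall x y, A x -> `|y - b| < rho -> S (x, y)) ->
  (forall x, A x -> `|g x - b| < rho /\ F (x, g x) = 0) ->
  smooth_on A g.
Proof.
move=> fV oA nF sF AS gF.
have dg := implicit_differentiable fV oA nF gF.
elim=> [|k IH]; first by move=> x /dg [d _]; exact: differentiable_continuous.
split=> [x /dg [] //|v].
have fVr : finite_coord (V * 'rV[R]_n)%type.
  by apply: finite_coord_pair => //; exact: finite_coord_rV.
have Cxg : Ck k A (fun x => (x, g x)).
  apply: Ck_pair => //.
  by apply: (@Ck_linear R k V V A idfun) => // x.
have CdF z : Ck k A (fun x => 'd F (x, g x) z).
  apply: (@Ck_comp R k V _ _ A S (fun x => (x, g x)) (fun y => 'd F y z)) => //.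
    by move=> x Ax; apply: AS => //; have [] := gF x Ax.
  by have [_] := sF k.+1; exact.
apply: (@Ck_eq_in R k V _ A
  (fun x => - ('d F (x, g x) (v, 0) *m invmx (partial_mx F (x, g x))))) => //.
  by move=> x /dg [].
apply: Ck_row => // j.
apply: (@Ck_eq_in R k V R A (fun x => (-1) * \sum_i ('d F (x, g x) (v, 0)) 0 i *
   invmx (partial_mx F (x, g x)) i j)) => //.
  by move=> x _; rewrite !mxE mulN1r.
apply: Ck_mul => //; first exact: Ck_cst.
apply: Ck_sum => // i _; apply: Ck_mul => //; first exact: Ck_coord.
apply: Ck_invmx => // [x Ax|i' j'].
  by apply: (partial_mx_unit nF) => //; have [] := gF x Ax.
apply: (@Ck_eq_in R k V R A (fun x => ('d F (x, g x) (0, evec R i')) 0 j')) => //.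
  by move=> x _; rewrite !mxE.
exact: Ck_coord.
Qed.

Theorem implicit_function F S a b :
  finite_coord V -> open S -> S (a, b) -> smooth_on S F ->
  F (a, b) = 0 -> (forall h, 'd F (a, b) (0, h) = h) ->
  exists (A : set V) (B : set 'rV[R]_n) (g : V -> 'rV[R]_n),
    [/\ open A, open B, A a & B b] /\
    [/\ smooth_on A g, forall x y, A x -> B y -> S (x, y),
        forall x, A x -> B (g x) /\ F (x, g x) = 0
      & forall x y, A x -> B y -> F (x, y) = 0 -> y = g x].
Proof.
move=> fV oS Sab sF Fab Fid.
have [A [rho [oA Aa rho0 nF AS]]] := near_id_exists oS Sab (sF 1%N) Fid.
have [A' [g [oA' A'a A'A gF]]] := near_id_solution oA Aa rho0 nF Fab.
have rho2 : rho / 2 < rho by rewrite ltr_pdivrMr // ltr_pMr // ltr1n.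
have nF' : near_id_on F A' b rho by move=> x y /A'A; exact: nF.
have gF' x : A' x -> `|g x - b| < rho /\ F (x, g x) = 0.
  by move=> /gF [gb Fx]; split => //; exact: lt_trans gb rho2.
exists A', (ball b (rho / 2)), g; split; split => //.
- exact: ball_open.
- by apply: ballxx; rewrite divr_gt0.
- apply: (implicit_smooth fV oA' nF' sF) => // x y /A'A; exact: AS.
- move=> x y /A'A Ax; rewrite -ball_normE /= distrC => yb.
  by apply: AS => //; exact: lt_trans yb rho2.
- move=> x /gF [gb Fx]; split => //; by rewrite -ball_normE /= distrC.
- move=> x y A'x; rewrite -ball_normE /= distrC => yb Fy; have [gb Fx] := gF' x A'x.
  have := near_id_inj nF' A'x (lt_trans yb rho2) gb.
  by rewrite Fy Fx subrr normr0 mulr0 normr_le0 subr_eq0 => /eqP.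
Qed.

End ImplicitSmooth.

(** * The lexicographic order on monomials *)

Section LexOrder.
Context {n : nat}.
Implicit Types m : multinom n.

Lemma lex_le_refl m : lex_le m m.
Proof. exact: le_refl. Qed.

Lemma lex_le_trans m2 m1 m3 : lex_le m1 m2 -> lex_le m2 m3 -> lex_le m1 m3.
Proof. exact: le_trans. Qed.

Lemma lex_le_anti m1 m2 : lex_le m1 m2 -> lex_le m2 m1 -> m1 = m2.
Proof. move=> h1 h2; apply: val_inj.
by apply: (@le_anti _ (n.-tuplelexi nat)); apply/andP. Qed.

Lemma lex_le_total m1 m2 : lex_le m1 m2 || lex_le m2 m1.
Proof. exact: le_total. Qed.

Lemma lex_leP m1 m2 : reflect
  (m1 = m2 \/ exists2 k : 'I_n,
    forall i : 'I_n, (i < k)%N -> m1 i = m2 i & (m1 k < m2 k)%N)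
  (lex_le m1 m2).
Proof.
rewrite /lex_le le_eqVlt; apply: (iffP orP).
  by move=> [/eqP/val_inj ->|/ltxi_tuplePlt]; [left|right].
move=> [->|h]; first by left.
by right; apply/ltxi_tuplePlt.
Qed.

Lemma lex_le_add m m1 m2 : lex_le m1 m2 -> lex_le (mnm_add m m1) (mnm_add m m2).
Proof.
move=> /lex_leP [->|[k h hk]]; first exact: lex_le_refl.
by apply/lex_leP; right; exists k => [i /h|]; rewrite !mnmDE ?ltn_add2l // => ->.
Qed.

Lemma lex_le_add2 m1 m2 k1 k2 : lex_le m1 k1 -> lex_le m2 k2 ->
  lex_le (mnm_add m1 m2) (mnm_add k1 k2).
Proof.
move=> h1 h2; apply: (lex_le_trans (lex_le_add m1 h2)).
by rewrite ![mnm_add _ k2]addmC; exact: lex_le_add.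
Qed.

(** Strict monotonicity of addition in the form used for leading terms: the
    largest possible product monomial is reached in one way only. *)
Lemma lex_le_addI m1 m2 k1 k2 : lex_le m1 k1 -> lex_le m2 k2 ->
  mnm_add m1 m2 = mnm_add k1 k2 -> m1 = k1.
Proof.
move=> h1 h2 E; apply: (lex_le_anti h1).
have : lex_le (mnm_add k1 m2) (mnm_add m1 m2).
  by rewrite E; exact: lex_le_add.
move=> /lex_leP [|[k h hk]].
  by rewrite ![mnm_add _ m2]addmC => /addmI ->; exact: lex_le_refl.
apply/lex_leP; right; exists k => [i /h|].
  by rewrite !mnmDE => /addIn.
by move: hk; rewrite !mnmDE ltn_add2r.
Qed.

Lemma lex_le0 m : lex_le mnm0 m.
Proof.
have [//|] := orP (lex_le_total mnm0 m).
move=> /lex_leP [->|[k _]]; first exact: lex_le_refl.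
by rewrite mnm0E ltn0.
Qed.

End LexOrder.

(** * Leading monomials and Groebner bases *)

Section LeadingMonomials.
Context {R : realType} {n : nat}.
Implicit Types (p q : mpoly n R) (m : multinom n).

(** An upper bound for the monomials, which need not occur in [p]: this
    version of a leading monomial is multiplicative with no condition on
    coefficients. *)
Definition lex_bounded p m := forall k, k \in msupp p -> lex_le k m.

Lemma lex_boundedM p q m1 m2 : lex_bounded p m1 -> lex_bounded q m2 ->
  lex_bounded (p * q) (mnm_add m1 m2).
Proof.
move=> bp bq k /msuppM_le /allpairsP [[k1 k2] /= [/bp h1 /bq h2 ->]].
exact: lex_le_add2.
Qed.

(** Remove from [p] its term in [m1]: by [lex_le_addI] the rest cannot
    contribute to the monomial [m1 + m2] of the product. *)
Lemma mcoeff_lexM p q m1 m2 : lex_bounded p m1 -> lex_bounded q m2 ->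
  mcoeff (mnm_add m1 m2) (p * q) = mcoeff m1 p * mcoeff m2 q.
Proof.
move=> bp bq; set c := mcoeff m1 p.
have cp' k : mcoeff k (p - c *: mpolyX R m1) = if k == m1 then 0 else mcoeff k p.
  rewrite mcoeffB mcoeffZ mcoeffX eq_sym; case: eqP => [->|_].
    by rewrite mulr1 subrr.
  by rewrite mulr0 subr0.
rewrite -(subrK (c *: mpolyX R m1) p) mulrDl mcoeffD.
rewrite -scalerAl mcoeffZ [mpolyX R m1 * q]mulrC mcoeffMX.
rewrite -[RHS]add0r; congr (_ + _).
apply: memN_msupp_eq0; apply/negP.
move=> /msuppM_le /allpairsP [[k1 k2] /= [h1 h2 E]].
move: h1; rewrite mcoeff_msupp cp'; case: (eqVneq k1 m1) => [_|/eqP ne].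
  by rewrite eqxx.
rewrite -mcoeff_msupp => /bp h1.
exact: ne (lex_le_addI h1 (bq _ h2) (esym E)).
Qed.

Lemma lex_lm_eq p m : lex_bounded p m -> mcoeff m p != 0 -> lex_lm p = m.
Proof.
rewrite -mcoeff_msupp /lex_lm /lex_bounded.
elim: (msupp p : seq _) => [//|k r IH] br; rewrite inE big_cons /lex_max => mkr.
have br' : forall k, k \in r -> lex_le k m.
  by move=> j jr; rewrite br // inE jr orbT.
have le_r : lex_le (\big[@lex_max n/mnm0]_(m <- r) m) m.
  elim: (r) br' => [|j s IHs] bs; first by rewrite big_nil; exact: lex_le0.
  rewrite big_cons /lex_max; case: ifP => _; last by rewrite bs // inE eqxx.
  by apply: IHs => i si; rewrite bs // inE si orbT.
case/orP: mkr => [/eqP <-|/(IH br') ->].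
  by case: ifP => [h|//]; apply: lex_le_anti => //; rewrite -?(eqP (eqxx m)).
by rewrite br // inE eqxx.
Qed.

Lemma mnm_le_coeff_mulX p m k : mcoeff k (p * mpolyX R m) != 0 ->
  forall i, (m i <= k i)%N.
Proof.
rewrite -mcoeff_msupp (perm_mem (msuppMX p m)) => /mapP [m' _ ->] i.
by rewrite mnmDE leq_addr.
Qed.

(** A monomial that lies in an ideal generated by monomials is divisible by one
    of the generators. *)
Lemma groebner_lm_dvd (I : mpoly n R -> Prop) s (g : 'I_s -> mpoly n R) f :
  groebner_basis I g -> I f -> mcoeff (lex_lm f) f != 0 ->
  exists2 i, g i != 0 & forall k, (lex_lm (g i) k <= lex_lm f k)%N.
Proof.
move=> [_ gb] If f0; have [c Ec] := gb f If.
have : mcoeff (lex_lm f) (lex_lt f) != 0.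
  by rewrite /lex_lt mcoeffZ mcoeffX eqxx mulr1.
rewrite Ec raddf_sum /= => nz.
have [i] : exists i, mcoeff (lex_lm f) (c i * lex_lt (g i)) != 0.
  apply/existsP; apply: contraNT nz => /existsPn h; apply/eqP/big1 => i _.
  by apply/eqP; rewrite -[_ == _]negbK; exact: h.
rewrite /lex_lt -scalerAr mcoeffZ mulf_eq0 negb_or => /andP [gi0 ci].
exists i; last exact: mnm_le_coeff_mulX ci.
by apply: contraNneq gi0 => ->; rewrite mcoeff0.
Qed.

End LeadingMonomials.

(** * Degree in eta of a remainder modulo the cubes *)

Section CubicIdeal.
Context {R : realType} {d : nat}.

Let diffXe (i : 'I_d) : mpoly (d + d) R := X_ R i - eta_ R i.

Lemma lex_bounded_diff i : lex_bounded (diffXe i) (mnm1 (lshift d i)).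
Proof.
move=> k; rewrite mcoeff_msupp mcoeffB /X_ /eta_ !mcoeffX.
have [<- _|_] := eqVneq (mnm1 (rshift d i)) k; last first.
  have [<- _|_] := eqVneq (mnm1 (lshift d i)) k; first exact: lex_le_refl.
  by rewrite subr0 eqxx.
apply/lex_leP; right; exists (lshift d i); last first.
  by rewrite !mnm1E eqxx eq_rlshift.
move=> j ji; rewrite !mnm1E.
have -> : (rshift d i == j) = false by rewrite -val_eqE /=; move: ji => /=; lia.
by rewrite -val_eqE /= gtn_eqF.
Qed.

Lemma mcoeff_diff i : mcoeff (mnm1 (lshift d i)) (diffXe i) = -1.
Proof.
rewrite mcoeffB /X_ /eta_ !mcoeffX eqxx.
case: eqP => [/mnmP/(_ (rshift d i))|_]; last by rewrite sub0r.
by rewrite !mnm1E eqxx eq_lrshift.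
Qed.

Lemma cubic_lead i j k :
  let f := diffXe i * diffXe j * diffXe k in
  let m := mnm_add (mnm_add (mnm1 (lshift d i)) (mnm1 (lshift d j)))
    (mnm1 (lshift d k)) in
  lex_lm f = m /\ mcoeff m f != 0.
Proof.
move=> f m.
have b2 := lex_boundedM (lex_bounded_diff (i:=i)) (lex_bounded_diff (i:=j)).
have b3 := lex_boundedM b2 (lex_bounded_diff (i:=k)).
have c3 : mcoeff m f != 0.
  rewrite /m /f (mcoeff_lexM b2 (lex_bounded_diff (i:=k))).
  rewrite (mcoeff_lexM (lex_bounded_diff (i:=i)) (lex_bounded_diff (i:=j))).
  by rewrite !mcoeff_diff !mulf_neq0 // oppr_eq0 oner_eq0.
by split => //; exact: lex_lm_eq.
Qed.

Lemma ideal_I3_cubic i j k : ideal_I3 (diffXe i * diffXe j * diffXe k).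
Proof.
exists (fun t => if t == (i, j, k) then 1 else 0).
rewrite (bigD1 (i, j, k)) //= eqxx mul1r big1 ?addr0 // => t /negPf ->.
by rewrite mul0r.
Qed.

(** Applied three times, this extracts the monomial [eta_i eta_j eta_k] from
    any monomial of degree at least 3 in eta. *)
Lemma eta_var_divides (m : multinom (d + d)) c :
  (c < \sum_(i < d) m (lshift d i))%N -> exists i (m' : multinom (d + d)),
    m = mnm_add (mnm1 (lshift d i)) m' /\ (c <= \sum_(i < d) m' (lshift d i))%N.
Proof.
move=> cm.
have [i mi] : exists i, (0 < m (lshift d i))%N.
  apply/existsP; apply: contraTT cm => /existsPn h.
  by rewrite big1 // => i _; move: (h i); rewrite -eqn0Ngt => /eqP.
pose m' := mnm_sub m (mnm1 (lshift d i)).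
have Em : m = mnm_add (mnm1 (lshift d i)) m'.
  rewrite addmC submK //; apply/mnm_lepP => j; rewrite mnm1E.
  by case: eqP => // <-.
exists i, m'; split => //; move: cm; rewrite {1}Em.
under eq_bigr => j _ do rewrite mnmDE mnm1E.
rewrite big_split /= (bigD1 i) //= eqxx big1 ?addn0 ?add1n ?ltnS //.
by move=> j ji; rewrite eq_lshift eq_sym (negPf ji).
Qed.

(** A monomial of degree at least 3 in eta is divisible by some
    [eta_i eta_j eta_k], hence by the leading monomial of an element of the
    basis, which cannot happen in a remainder. *)
Lemma remainder_deg_eta s (G : 'I_s -> mpoly (d + d) R) f r :
  groebner_basis (@ideal_I3 R d) G -> is_remainder G f r -> (deg_eta r <= 2)%N.
Proof.
move=> gb [q [_ _ red]]; rewrite /deg_eta.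
apply/bigmax_leqP_seq => m mr _; rewrite leqNgt; apply/negP => m3.
have [i [m1 [E1 m1s]]] := eta_var_divides m3.
have [j [m2 [E2 m2s]]] := eta_var_divides m1s.
have [k [m4 [E4 _]]] := eta_var_divides m2s.
have [lmf cf] := cubic_lead i j k.
have := groebner_lm_dvd gb (ideal_I3_cubic i j k).
rewrite lmf => /(_ cf) [t gt0 tm]; apply: (red m mr t gt0) => l.
apply: leq_trans (tm l) _; rewrite E1 E2 E4 !mnmDE; lia.
Qed.

End CubicIdeal.

(** * Orthogonal complements and complementary subspaces *)

Section LinearAlgebra.
Context {R : realType}.

Lemma posdef_unit n (M : 'M[R]_n) : posdef M -> M \in unitmx.
Proof.
move=> [_ pM]; rewrite -row_free_unit -kermx_eq0; apply/eqP/row_matrixP => i.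
rewrite row0; apply/eqP/negP => /negP nz.
by have := pM _ nz; rewrite -row_mul mulmx_ker row0 mul0mx mxE ltxx.
Qed.

Lemma posdef_inv n (M : 'M[R]_n) : posdef M -> posdef (invmx M).
Proof.
move=> pM; have uM := posdef_unit pM; have [sM gM] := pM.
split; first by rewrite trmx_inv sM.
move=> x x0; have := gM (x *m invmx M).
have -> : x *m invmx M *m M *m (x *m invmx M)^T = x *m invmx M *m x^T.
  by rewrite mulmxKV // trmx_mul trmx_inv sM mulmxA.
apply; apply: contraNneq x0 => E; by rewrite -(mulmxKV uM x) E mul0mx.
Qed.

(** As [G] is symmetric, a vector is G-orthogonal to the rows of [B] exactly when
    it is orthogonal, in the Euclidean sense, to the rows of [B G]. *)
Lemma mulmx_sub_orthomx p d (G : 'M[R]_d) (B : 'M[R]_(p, d)) : G^T = G ->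
  (B *m G <= orthomx idfun 1%:M (orthomx idfun G B))%MS.
Proof.
move=> sG; rewrite /orthomx; apply/sub_kermxP; rewrite mul1mx.
have mid m n (M : 'M[R]_(m, n)) : map_mx idfun M = M.
  by apply/matrixP => i j; rewrite mxE.
rewrite !mid -{1}sG -[X in X *m _]trmxK trmx_mul trmxK -trmx_mul.
by rewrite mulmxA -[_ *m G *m _]mulmxA mulmx_ker trmx0.
Qed.

(** If [x B E^T = 0] then [x B G B^T x^T = x (M E) B^T x^T = 0], so [x B = 0]
    because [G] is positive definite, and [x = 0] because [B] has full rank. *)
Lemma pairing_unit p d (G : 'M[R]_d) (B E : 'M[R]_(p, d)) (M : 'M[R]_p) :
  posdef G -> \rank B = p -> B *m G = M *m E -> B *m E^T \in unitmx.
Proof.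
move=> [sG pG] rB BG; rewrite -row_free_unit -kermx_eq0.
apply/eqP/row_matrixP => i; rewrite row0.
set x := row i _.
have xBE : x *m (B *m E^T) = 0 by rewrite -row_mul mulmx_ker row0.
have rfB : row_free B by rewrite /row_free rB.
have xBG : x *m B *m G *m (x *m B)^T = 0.
  have E0 : E *m (x *m B)^T = 0.
    by rewrite -[LHS]trmxK trmx_mul trmxK -mulmxA xBE trmx0.
  by rewrite -[x *m B *m G]mulmxA BG -!mulmxA E0 !mulmx0.
have xB0 : x *m B = 0.
  by apply/eqP; apply: contraT => /pG; rewrite xBG mxE ltxx.
by apply: (row_free_inj rfB); rewrite xB0 mul0mx.
Qed.

(** The rows of [C] are a basis of the kernel of [A^T] and those of [D] span a
    complement of it; [C'] and [A^T] read off the two blocks of coordinates. *)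
Lemma complement_splitting p d (A D : 'M[R]_(p, d)) : D *m A^T = 1%:M ->
  exists (C : 'M[R]_(d - p, d)) (C' : 'M[R]_(d, d - p)),
    [/\ C *m A^T = 0, C *m C' = 1%:M, D *m C' = 0 & C' *m C + A^T *m D = 1%:M].
Proof.
move=> DA.
have rA : \rank A = p.
  apply/eqP; rewrite eqn_leq rank_leq_row /= -mxrank_tr.
  by rewrite -{1}(mxrank1 R p) -DA mxrankM_maxr.
have [C [CA rfC AC]] : exists C : 'M[R]_(d - p, d),
    [/\ C *m A^T = 0, row_free C & (kermx A^T <= C)%MS].
  have rk : \rank (kermx A^T) = (d - p)%N by rewrite mxrank_ker mxrank_tr rA.
  have : exists C : 'M[R]_(\rank (kermx A^T), d),
      [/\ C *m A^T = 0, row_free C & (kermx A^T <= C)%MS].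
    exists (row_base (kermx A^T)); split; last by rewrite eq_row_base.
      by apply/sub_kermxP; rewrite eq_row_base.
    exact: row_base_free.
  by rewrite rk.
(* The projection onto the kernel of [A^T] along the rows of [D]. *)
pose P := 1%:M - A^T *m D.
have PA : (P <= C)%MS.
  apply: submx_trans AC; apply/sub_kermxP.
  by rewrite mulmxBl mul1mx -mulmxA DA mulmx1 subrr.
exists C, (P *m pinvmx C); split => //.
- have CP : C *m P = C by rewrite /P mulmxBr mulmx1 mulmxA CA mul0mx subr0.
  by rewrite mulmxA CP mulmxVp.
- have DP : D *m P = 0 by rewrite /P mulmxBr mulmx1 mulmxA DA mul1mx subrr.
  by rewrite mulmxA DP mul0mx.
- by rewrite mulmxKpV // subrK.
Qed.

End LinearAlgebra.

(** * Evaluation of a remainder *)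

Section Remainders.
Context {R : realType} {d : nat}.

Definition value_matrix p (e : 'I_p -> 'I_d -> mpoly d R) (y : 'rV[R]_d) :
  'M[R]_(p, d) := \matrix_(j, i) meval (y 0) (e j i).

Lemma eval_X x y (i : 'I_d) : eval_X_eta (X_ R i) x y = x 0 i.
Proof. by rewrite /eval_X_eta /X_ mevalXU row_mxEr. Qed.

Lemma eval_eta x y (i : 'I_d) : eval_X_eta (eta_ R i) x y = y 0 i.
Proof. by rewrite /eval_X_eta /eta_ mevalXU row_mxEl. Qed.

Lemma eval_in_eta (f : mpoly d R) x y : eval_X_eta (in_eta f) x y = meval (y 0) f.
Proof.
rewrite /eval_X_eta /in_eta comp_mpoly_meval; apply: meval_eq => i.
by rewrite tnth_mktuple; exact: eval_eta.
Qed.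

Lemma eval_pairing (e : 'I_d -> mpoly d R) x y :
  eval_X_eta (pairing_X_eta e) x y =
  \sum_i (x 0 i - y 0 i) * meval (y 0) (e i).
Proof.
rewrite /pairing_X_eta /eval_X_eta raddf_sum /=; apply: eq_bigr => i _.
rewrite mevalM mevalB -![meval _ _]/(eval_X_eta _ x y).
by rewrite eval_X eval_eta eval_in_eta.
Qed.

(** The functional content of congruence modulo the ideal of the cubes; the
    analytic part of the argument sees the ideal only through it. *)
Definition pairing_mod_cubes (e : 'I_d -> mpoly d R) (r : mpoly (d + d) R) :=
  exists c : 'I_d * 'I_d * 'I_d -> mpoly (d + d) R, forall x y,
    eval_X_eta r x y = \sum_i (x 0 i - y 0 i) * meval (y 0) (e i) +
      \sum_t eval_X_eta (c t) x y *
        ((x 0 t.1.1 - y 0 t.1.1) * (x 0 t.1.2 - y 0 t.1.2) *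
         (x 0 t.2 - y 0 t.2)).

Lemma remainder_in_ideal n s (I : finType) (gen : I -> mpoly n R)
    (G : 'I_s -> mpoly n R) f r :
  groebner_basis (in_ideal gen) G -> is_remainder G f r -> in_ideal gen (f - r).
Proof.
move=> [GI _] [q [-> _ _]].
pose c i := sval (cid (GI i)).
have Gc i : G i = \sum_t c i t * gen t by rewrite /c; case: cid.
exists (fun t => \sum_i q i * c i t).
rewrite addrK.
under [RHS]eq_bigr => t _ do rewrite mulr_suml.
rewrite exchange_big; apply: eq_bigr => i _ /=.
rewrite [in LHS]Gc mulr_sumr; apply: eq_bigr => t _; by rewrite mulrA.
Qed.

Lemma eval_remainder s (G : 'I_s -> mpoly (d + d) R) (e : 'I_d -> mpoly d R) r :
  groebner_basis (@ideal_I3 R d) G -> is_remainder G (pairing_X_eta e) r ->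
  pairing_mod_cubes e r.
Proof.
move=> gb rem; have [c Ec] := remainder_in_ideal gb rem.
exists (fun t => - c t) => x y.
have -> : r = pairing_X_eta e - (pairing_X_eta e - r) by rewrite opprB addrC subrK.
rewrite Ec /eval_X_eta mevalB -/(eval_X_eta _ x y) eval_pairing; congr (_ + _).
rewrite [meval _ _](raddf_sum (meval _)) /= -sumrN; apply: eq_bigr => t _.
rewrite mevalN mulNr !mevalM !mevalB -![meval _ _]/(eval_X_eta _ x y).
by rewrite !eval_X !eval_eta.
Qed.

End Remainders.

(** * Second derivatives of products *)

Section SecondDerivatives.
Context {R : realType} {V : normedModType R}.

Lemma Ck_derive k (W : normedModType R) (O : set V) (f : V -> W) v : open O ->
  Ck k.+1 O f -> Ck k O ('D_v f).
Proof.
move=> oO [df cf]; apply: (Ck_eq_in oO _ (cf v)) => x Ox.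
by rewrite deriveE //; exact: df.
Qed.

Lemma Ck_derivable k (W : normedModType R) (O : set V) (f : V -> W) x v :
  Ck k.+1 O f -> O x -> derivable f x v.
Proof. by move=> [df _] Ox; apply: diff_derivable; exact: df. Qed.

Arguments Ck_derivable {k W O f x} v _ _.

Lemma near_open_eq_derive (W : normedModType R) (O : set V) (f g : V -> W) x v :
  open O -> O x -> (forall y, O y -> f y = g y) -> 'D_v f x = 'D_v g x.
Proof.
move=> oO Ox fg; apply: near_eq_derive.
by apply: filterS (open_nbhs_nbhs (conj oO Ox)) => y /fg.
Qed.

Lemma derive2_add (O : set V) (f g : V -> R) x v w : open O -> O x ->
  Ck 2 O f -> Ck 2 O g ->
  'D_w ('D_v (fun y => f y + g y)) x = 'D_w ('D_v f) x + 'D_w ('D_v g) x.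
Proof.
move=> oO Ox Cf Cg.
rewrite -(deriveD (Ck_derivable _ (Ck_derive v oO Cf) Ox)
  (Ck_derivable _ (Ck_derive v oO Cg) Ox)).
apply: (near_open_eq_derive _ oO Ox) => y Oy.
exact: (deriveD (Ck_derivable v Cf Oy) (Ck_derivable v Cg Oy)).
Qed.

Lemma derive2_mul (O : set V) (f g : V -> R) x v w : open O -> O x ->
  Ck 2 O f -> Ck 2 O g ->
  'D_w ('D_v (fun y => f y * g y)) x =
  f x * 'D_w ('D_v g) x + 'D_v g x * 'D_w f x +
  (g x * 'D_w ('D_v f) x + 'D_v f x * 'D_w g x).
Proof.
move=> oO Ox Cf Cg.
have Df := Ck_derivable w (Ck_derive v oO Cf) Ox.
have Dg := Ck_derivable w (Ck_derive v oO Cg) Ox.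
have df := Ck_derivable w Cf Ox; have dg := Ck_derivable w Cg Ox.
transitivity ('D_w (f * 'D_v g + g * 'D_v f) x).
  apply: (near_open_eq_derive _ oO Ox) => y Oy.
  exact: (deriveM (Ck_derivable v Cf Oy) (Ck_derivable v Cg Oy)).
rewrite (deriveD (derivableM df Dg) (derivableM dg Df)).
by rewrite (deriveM df Dg) (deriveM dg Df).
Qed.

Lemma derive2_cubic (O : set V) (c f g h : V -> R) x v w : open O -> O x ->
  Ck 2 O c -> Ck 2 O f -> Ck 2 O g -> Ck 2 O h ->
  f x = 0 -> g x = 0 -> h x = 0 ->
  'D_w ('D_v (fun y => c y * (f y * g y * h y))) x = 0.
Proof.
move=> oO Ox Cc Cf Cg Ch f0 g0 h0.
have Cfg := Ck_mul oO Cf Cg; have Cfgh := Ck_mul oO Cfg Ch.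
have Dfg z : 'D_z (fun y => f y * g y) x = 0.
  have := deriveM (Ck_derivable z Cf Ox) (Ck_derivable z Cg Ox).
  by rewrite f0 g0 !scale0r addr0.
have Dfgh z : 'D_z (fun y => f y * g y * h y) x = 0.
  have := deriveM (Ck_derivable z Cfg Ox) (Ck_derivable z Ch Ox).
  by rewrite /= f0 h0 mul0r !scale0r addr0.
rewrite (derive2_mul _ _ oO Ox Cc Cfgh) !Dfgh.
rewrite (derive2_mul _ _ oO Ox Cfg Ch) !Dfg f0 h0.
move: ('D_w ('D_v c) x) ('D_w c x) ('D_v c x) => a1 a2 a3.
move: ('D_w ('D_v h) x) ('D_v h x) ('D_w h x) => a4 a5 a6.
move: ('D_w ('D_v (fun y => f y * g y)) x) => a7.
by rewrite !(mul0r, mulr0, addr0).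
Qed.

Lemma derive2_sum (O : set V) I (r : seq I) (f : I -> V -> R) x v w :
  open O -> O x -> (forall i, Ck 2 O (f i)) ->
  'D_w ('D_v (fun y => \sum_(i <- r) f i y)) x = \sum_(i <- r) 'D_w ('D_v (f i)) x.
Proof.
move=> oO Ox Cf; elim: r => [|i r IH].
  rewrite big_nil; have -> : (fun y => \sum_(i <- [::]) f i y) = cst (0 : R).
    by apply/funext => y; rewrite big_nil.
  have -> : 'D_v (cst (0 : R)) = cst (0 : R).
    by apply/funext => y; rewrite derive_cst.
  by rewrite derive_cst.
have -> : (fun y => \sum_(j <- i :: r) f j y) = (fun y => f i y + \sum_(j <- r) f j y).
  by apply/funext => y; rewrite big_cons.
rewrite big_cons -IH; apply: (derive2_add _ _ oO Ox) => //.
by apply: Ck_sum.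
Qed.

End SecondDerivatives.
Arguments Ck_derivable {R V k W O f x} v _ _.

(** * Second-order content of the estimating equations *)

Section Efficiency.
Context {R : realType} {d : nat}.

Lemma Ck_eval_X_eta k (V : normedModType R) (U : set V) (f g : V -> 'rV[R]_d)
    (c : mpoly (d + d) R) : open U -> Ck k U f -> Ck k U g ->
  Ck k U (fun x => eval_X_eta c (f x) (g x)).
Proof.
move=> oU Cf Cg; apply: (@Ck_meval R k V _ U (fun x => row_mx (g x) (f x))) => //.
apply: Ck_row => // i; case: (splitP i) => j ij.
  have -> : i = lshift d j by apply/val_inj.
  apply: (@Ck_eq_in R k V R U (fun x => g x 0 j)) => //; last exact: Ck_coord.
  by move=> x _; rewrite row_mxEl.
have -> : i = rshift d j by apply/val_inj.
apply: (@Ck_eq_in R k V R U (fun x => f x 0 j)) => //; last exact: Ck_coord.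
by move=> x _; rewrite row_mxEr.
Qed.

(** Every summand of the cubic part has three factors that vanish at [x], so
    its second derivatives at [x] vanish; those of the linear part, whose
    coefficients [P i] do not depend on the point, are what remains. *)
Lemma estimating_curve_second_derivative (V : normedModType R) (O : set V)
    (h : V -> 'rV[R]_d) (P : 'I_d -> R)
    (c : 'I_d * 'I_d * 'I_d -> mpoly (d + d) R) x v w :
  open O -> O x -> Ck 2 O h ->
  (forall z, O z -> \sum_i (h z 0 i - h x 0 i) * P i +
      \sum_t eval_X_eta (c t) (h z) (h x) *
        ((h z 0 t.1.1 - h x 0 t.1.1) * (h z 0 t.1.2 - h x 0 t.1.2) *
         (h z 0 t.2 - h x 0 t.2)) = 0) ->
  \sum_i 'D_w ('D_v (fun z => h z 0 i)) x * P i = 0.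
Proof.
move=> oO Ox Ch E.
have Cz i : Ck 2 O (fun z => h z 0 i - h x 0 i).
  exact: (Ck_add oO (Ck_coord i oO Ch) (Ck_cst 2 O (- h x 0 i))).
have Cc t : Ck 2 O (fun z => eval_X_eta (c t) (h z) (h x)).
  exact: (Ck_eval_X_eta (c t) oO Ch (Ck_cst 2 O (h x))).
pose lin i z := (h z 0 i - h x 0 i) * P i.
pose cub (t : 'I_d * 'I_d * 'I_d) z := eval_X_eta (c t) (h z) (h x) *
    ((h z 0 t.1.1 - h x 0 t.1.1) * (h z 0 t.1.2 - h x 0 t.1.2) *
     (h z 0 t.2 - h x 0 t.2)).
have Clin i : Ck 2 O (lin i) := Ck_mul oO (Cz i) (Ck_cst 2 O (P i)).
have Ccub t : Ck 2 O (cub t) :=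
  Ck_mul oO (Cc t) (Ck_mul oO (Ck_mul oO (Cz _) (Cz _)) (Cz _)).
have E1 := derive2_sum (index_enum _) v w oO Ox Clin.
have E2 := derive2_sum (index_enum _) v w oO Ox Ccub.
have E0 := derive2_add v w oO Ox (Ck_sum (index_enum _) oO (fun i _ => Clin i))
  (Ck_sum (index_enum _) oO (fun t _ => Ccub t)).
have cub0 t : 'D_w ('D_v (cub t)) x = 0.
  by apply: (derive2_cubic v w oO Ox (Cc t) (Cz _) (Cz _) (Cz _)); rewrite subrr.
have Z : 'D_w ('D_v (fun y => \sum_i lin i y + \sum_t cub t y)) x = 0.
  transitivity ('D_w (cst (0 : R)) x); last by rewrite derive_cst.
  apply: (near_open_eq_derive _ oO Ox) => y Oy.
  transitivity ('D_v (cst (0 : R)) y); last by rewrite derive_cst.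
  by apply: (near_open_eq_derive _ oO Oy) => z /E.
have : \sum_i 'D_w ('D_v (lin i)) x = 0.
  have s0 : \sum_t 'D_w ('D_v (cub t)) x = 0 by apply: big1 => t _; exact: cub0.
  by rewrite -[LHS]addr0 -{}[X in _ + X = _]s0 -E1 -E2 -E0.
move=> lin0; rewrite -[RHS]lin0; apply: eq_bigr => i _.
have Dc (a : R) z : 'D_z (fun _ : V => a) x = 0 := derive_cst a x z.
have D2c (a : R) : 'D_w ('D_v (fun _ : V => a)) x = 0.
  have -> : 'D_v (fun _ : V => a) = cst 0 by apply/funext => y; exact: derive_cst.
  exact: derive_cst.
have Emul := derive2_mul v w oO Ox (Cz i) (Ck_cst 2 O (P i)).
have Eadd := derive2_add v w oO Ox (Ck_coord i oO Ch) (Ck_cst 2 O (- h x 0 i)).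
apply: esym; apply: etrans Emul _.
rewrite (D2c (P i)) (Dc (P i) v) (Dc (P i) w) Eadd (D2c (- h x 0 i)).
move: ('D_w ('D_v (fun y => h y 0 i)) x) => a.
move: ('D_v (fun z => h z 0 i - h x 0 i) x) => b.
move: ('D_w (fun z => h z 0 i - h x 0 i) x) => b'.
by rewrite !(mulr0, mul0r, addr0, add0r) mulrC.
Qed.

End Efficiency.

(** * First derivatives *)

Section FirstDerivatives.
Context {R : realType}.
Implicit Types V W : normedModType R.

(** For maps that are affine along one line, the derivative in that direction is
    read off without differentiating the rest of the map. *)
Lemma derive_along_line V W (f : V -> W) x v w :
  (forall t, f (t *: v + x) - f x = t *: w) -> 'D_v f x = w.
Proof.
move=> fl; rewrite /derive; apply: cvg_lim => //.
apply: (@cvg_trans _ ((fun=> w) @ (0 : R)^')); last exact: cvg_cst.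
apply: near_eq_cvg; near=> t.
rewrite /= fl scalerA mulVf ?scale1r //.
by near: t; exact: nbhs_dnbhs_neq.
Unshelve. all: by end_near. Qed.

Lemma derive_sumr V (O : set V) I (r : seq I) (f : I -> V -> R) x v :
  open O -> O x -> (forall i, Ck 1 O (f i)) ->
  'D_v (fun y => \sum_(i <- r) f i y) x = \sum_(i <- r) 'D_v (f i) x.
Proof.
move=> oO Ox Cf; elim: r => [|i r IH].
  rewrite big_nil; have -> : (fun y => \sum_(i <- [::]) f i y) = cst (0 : R).
    by apply/funext => y; rewrite big_nil.
  exact: derive_cst.
have -> : (fun y => \sum_(j <- i :: r) f j y) = (f i + (fun y => \sum_(j <- r) f j y)).
  by apply/funext => y; rewrite big_cons.
rewrite big_cons -IH; apply: deriveD; first exact: Ck_derivable (Cf i) Ox.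
exact: Ck_derivable (Ck_sum r oO (fun i _ => Cf i)) Ox.
Qed.

Lemma derive_mul0 V (O : set V) (f g : V -> R) x v : O x ->
  Ck 1 O f -> Ck 1 O g -> f x = 0 -> 'D_v (fun y => f y * g y) x = 'D_v f x * g x.
Proof.
move=> Ox Cf Cg f0.
apply: etrans (deriveM (Ck_derivable v Cf Ox) (Ck_derivable v Cg Ox)) _.
by rewrite f0 scale0r add0r mulrC.
Qed.

Lemma diff_coord V n (f : V -> 'rV[R]_n) x v i : differentiable f x ->
  ('d f x v) 0 i = 'D_v (fun y => f y 0 i) x.
Proof.
move=> df; rewrite -deriveE // derive_mx ?mxE //.
exact: diff_derivable.
Qed.

Lemma diff_jacobian m n (f : 'rV[R]_m -> 'rV[R]_n) x v :
  'd f x v = v *m jacobian f x.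
Proof. by rewrite /jacobian mul_rV_lin1. Qed.

Lemma Ck_mulmx k V m n (U : set V) (f : V -> 'rV[R]_m) (M : 'M[R]_(m, n)) :
  open U -> Ck k U f -> Ck k U (fun x => f x *m M).
Proof.
move=> oU Cf; apply: (@Ck_comp_linear R k V _ _ U f (mulmxr M) oU _ Cf).
by apply: finite_coord_continuous; exact: finite_coord_rV.
Qed.

End FirstDerivatives.

(** * The Fisher metric as a Jacobian matrix *)

Section NaturalParameters.
Context {R : realType} {d : nat}.

Lemma jacobian_grad (psi : 'rV[R]_d -> R) t :
  differentiable (grad psi) t -> jacobian (grad psi) t = hessian psi t.
Proof.
move=> dg; apply/matrixP => i j; rewrite !mxE diff_coord //.
have -> // : (fun s => grad psi s 0 j) = 'D_(evec R j) psi.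
by apply/funext => s; rewrite mxE.
Qed.

(** The chain rule for [th \o grad psi = id]: the Jacobian matrix of [grad psi]
    is the Hessian of [psi], so that of its inverse is the inverse matrix. *)
Lemma diff_natural_parameter (T : set 'rV[R]_d) psi th t :
  diffeo_with_inverse T (grad psi) th -> T t ->
  differentiable th (grad psi t) /\
  forall v, 'd th (grad psi t) v = v *m fisher_eta psi th (grad psi t).
Proof.
move=> [oT sg oI sth thK] Tt.
have dg : differentiable (grad psi) t := (sg 1%N).1 t Tt.
have Igt : (grad psi @` T) (grad psi t) by exists t.
have dth : differentiable th (grad psi t) := (sth 1%N).1 _ Igt.
split=> // v; rewrite diff_jacobian /fisher_eta thK //.
set J := jacobian th _.
have HJ (w : 'rV[R]_d) : w *m (hessian psi t *m J) = w.
  rewrite mulmxA -(jacobian_grad dg) -(diff_jacobian (grad psi) t w) /J.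
  rewrite -(diff_jacobian th (grad psi t)).
  have nid : {near t, th \o grad psi =1 id}.
    by apply: filterS (open_nbhs_nbhs (conj oT Tt)) => s; exact: thK.
  have [_ E] := diff_near_eq nid (differentiable_comp dg dth).
  have E2 := diff_comp dg dth.
  apply: etrans (congr1 (fun f => f w) (esym E2)) _.
  apply: etrans (congr1 (fun f => f w) (esym E)) _.
  have Eid : 'd id t = id :> ('rV[R]_d -> 'rV[R]_d).
    exact: (diff_val (is_diff_def := is_diff_id t)).
  exact: (congr1 (fun f => f w) Eid).
have HJ1 : hessian psi t *m J = 1%:M.
  by apply/row_matrixP => i; rewrite !rowE HJ mulmx1.
have [uH _] := mulmx1_unit HJ1.
by rewrite -[J](mulKmx uH) HJ1 mulmx1.
Qed.

End NaturalParameters.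

(** * The estimating map near the diagonal *)

Section EstimatingMap.
Context {R : realType} {d p : nat}.

Definition estimating_map (r : 'I_p -> mpoly (d + d) R)
    (z : ('rV[R]_d * 'rV[R]_d)%type) : 'rV[R]_p :=
  \row_j eval_X_eta (r j) z.1 z.2.

Lemma Ck_estimating_map k (V : normedModType R) (U : set V)
    (f g : V -> 'rV[R]_d) r : open U -> Ck k U f -> Ck k U g ->
  Ck k U (fun x => estimating_map r (f x, g x)).
Proof.
move=> oU Cf Cg; apply: Ck_row => // j.
apply: (@Ck_eq_in R k V R U (fun x => eval_X_eta (r j) (f x) (g x))) => //.
  by move=> x _; rewrite mxE.
exact: Ck_eval_X_eta.
Qed.

Lemma differentiable_estimating_map r z : differentiable (estimating_map r) z.
Proof.
pose V := ('rV[R]_d * 'rV[R]_d)%type; have oT : open [set: V] by exact: openT.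
have Cf : Ck 1 [set: V] (fst : V -> 'rV[R]_d).
  by apply: (@Ck_linear R 1 V _ [set: V] fst oT) => x; exact: cvg_fst.
have Cs : Ck 1 [set: V] (snd : V -> 'rV[R]_d).
  by apply: (@Ck_linear R 1 V _ [set: V] snd oT) => x; exact: cvg_snd.
have -> : estimating_map r = (fun z : V => estimating_map r (z.1, z.2)).
  by apply/funext => -[].
exact: (Ck_estimating_map r oT Cf Cs).1.
Qed.

Lemma estimating_map_diag (e : 'I_p -> 'I_d -> mpoly d R) r y :
  (forall j, pairing_mod_cubes (e j) (r j)) -> estimating_map r (y, y) = 0.
Proof.
move=> er; apply/rowP => j; rewrite !mxE /=; have [c ->] := er j.
rewrite !big1 ?addr0 // => [t _|i _]; first by rewrite !subrr !mulr0.
by rewrite subrr mul0r.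
Qed.

(** On the diagonal, a product of which one factor is a difference
    [x_i - y_i] has a derivative in which only that factor is differentiated;
    the cubes contribute nothing, and the pairing contributes its coefficients
    at [y]. *)
Lemma diff_estimating_map (e : 'I_p -> 'I_d -> mpoly d R) r y h k :
  (forall j, pairing_mod_cubes (e j) (r j)) ->
  'd (estimating_map r) (y, y) (h, k) = (h - k) *m (value_matrix e y)^T.
Proof.
move=> er; pose V := ('rV[R]_d * 'rV[R]_d)%type.
have oT : open [set: V] by exact: openT.
have fV : finite_coord V by apply: finite_coord_pair; exact: finite_coord_rV.
have Cfst n : Ck n [set: V] (fst : V -> 'rV[R]_d).
  by apply: (@Ck_linear R n V _ [set: V] fst oT) => x; exact: cvg_fst.
have Csnd n : Ck n [set: V] (snd : V -> 'rV[R]_d).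
  by apply: (@Ck_linear R n V _ [set: V] snd oT) => x; exact: cvg_snd.
apply/rowP => j; rewrite (diff_coord _ _ (differentiable_estimating_map r _)).
have [c Ec] := er j.
pose z i (x : V) : R := x.1 0 i - x.2 0 i.
have linz i : exists L : {linear V -> R}, continuous L /\ L = z i :> (V -> R).
  have lin : linear (z i).
    move=> a [u1 u2] [v1 v2]; rewrite /z /= !mxE.
    by rewrite scalerBr /GRing.scale /=; ring.
  pose LM := GRing.isLinear.Build _ _ _ _ _ lin.
  pose L : {linear V -> R} := HB.pack (z i) LM.
  by exists L; split => //; exact: finite_coord_continuous.
have Cz i : Ck 1 [set: V] (z i).
  by have [L [cL <-]] := linz i; exact: Ck_linear.
have Dz i : 'D_(h, k) (z i) (y, y) = h 0 i - k 0 i.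
  have [L [cL EL]] := linz i; rewrite -[in LHS]EL.
  rewrite deriveE; last exact: linear_differentiable.
  by rewrite (diff_lin _ cL) EL.
have z0 i : z i (y, y) = 0 by rewrite /z subrr.
pose P i (x : V) : R := meval (x.2 0) (e j i).
have CP i : Ck 1 [set: V] (P i) := Ck_meval (e j i) oT (Csnd 1%N).
have Cc t : Ck 1 [set: V] (fun x : V => eval_X_eta (c t) x.1 x.2) :=
  Ck_eval_X_eta (c t) oT (Cfst 1%N) (Csnd 1%N).
pose lin i (x : V) := z i x * P i x.
pose cub (t : 'I_d * 'I_d * 'I_d) (x : V) :=
  z t.1.1 x * (eval_X_eta (c t) x.1 x.2 * (z t.1.2 x * z t.2 x)).
have Clin i : Ck 1 [set: V] (lin i) := Ck_mul oT (Cz i) (CP i).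
have Crest t : Ck 1 [set: V]
    (fun x : V => eval_X_eta (c t) x.1 x.2 * (z t.1.2 x * z t.2 x)) :=
  Ck_mul oT (Cc t) (Ck_mul oT (Cz _) (Cz _)).
have Ccub t : Ck 1 [set: V] (cub t) := Ck_mul oT (Cz _) (Crest t).
have Dlin i : 'D_(h, k) (lin i) (y, y) = (h 0 i - k 0 i) * meval (y 0) (e j i).
  by apply: etrans (derive_mul0 _ I (Cz i) (CP i) (z0 i)) _; rewrite Dz.
have Dcub t : 'D_(h, k) (cub t) (y, y) = 0.
  apply: etrans (derive_mul0 _ I (Cz _) (Crest t) (z0 _)) _.
  by rewrite !z0 !mulr0.
have -> : (fun x : V => estimating_map r x 0 j) =
    (fun x => \sum_i lin i x) + (fun x => \sum_t cub t x).
  apply/funext => x; rewrite mxE Ec; congr (_ + _).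
  by apply: eq_bigr => t _; rewrite /cub /z; ring.
have E1 := derive_sumr (index_enum _) (h, k) oT (I : [set: V] (y, y)) Clin.
have E2 := derive_sumr (index_enum _) (h, k) oT (I : [set: V] (y, y)) Ccub.
apply: etrans (deriveD
  (Ck_derivable (h, k) (Ck_sum (index_enum _) oT (fun i _ => Clin i)) I)
  (Ck_derivable (h, k) (Ck_sum (index_enum _) oT (fun i _ => Ccub i)) I)) _.
apply: etrans (congr2 +%R E1 E2) _.
rewrite [X in _ + X]big1 ?addr0; last by move=> t _; exact: Dcub.
rewrite mxE; apply: eq_bigr => i _.
by rewrite Dlin !mxE.
Qed.

End EstimatingMap.

(** * Existence of an estimator *)

Section Existence.
Context {R : realType}.

Lemma open_preimage_in (V W : normedModType R) (A : set V) (B : set W) (f : V -> W) :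
  open A -> (forall x, A x -> {for x, continuous f}) -> open B ->
  open [set x | A x /\ B (f x)].
Proof.
move=> oA cf oB; rewrite openE => x [Ax Bfx] /=.
rewrite /interior /=.
have nB : nbhs (f x) B by exact: open_nbhs_nbhs.
have nA : nbhs x A by exact: open_nbhs_nbhs.
by apply: filterS2 nA (cf x Ax _ nB) => y Ay By.
Qed.

(** With [A] the matrix of the [e_j] at [u0], write a point near [etaE u] as
    [etaE u + v C + w D].  The equations determine [w] from [(u, v)], since
    their differential in [w] is [D A^T = 1]; they also determine [u] from the
    point, since their differential in [u] is [- B A^T], which is invertible.
    The first solution gives [H], the second one its inverse [K]. *)
Lemma estimator_exists (d p : nat) (U : set 'rV[R]_p) u0 (etaE : 'rV[R]_p -> 'rV[R]_d)
    (W : set 'rV[R]_d) (e : 'I_p -> 'I_d -> mpoly d R) r :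
  open U -> U u0 -> smooth_on U etaE -> open W -> W (etaE u0) ->
  (forall j, pairing_mod_cubes (e j) (r j)) ->
  jacobian etaE u0 *m (value_matrix e (etaE u0))^T \in unitmx ->
  exists (O : set ('rV[R]_p * 'rV[R]_(d - p)))
         (H : 'rV[R]_p * 'rV[R]_(d - p) -> 'rV[R]_d),
    estimator U u0 etaE W O H /\ estimating_equations r etaE O H.
Proof.
move=> oU Uu0 sE oW Wy er uBE.
set y0 := etaE u0 in Wy uBE *.
set A := value_matrix e y0 in uBE *.
set B := jacobian etaE u0 in uBE *.
have [D DA] : exists D : 'M[R]_(p, d), D *m A^T = 1%:M.
  by exists (invmx (B *m A^T) *m B); rewrite -mulmxA mulVmx.
have [C [C' [CA CC' DC' split1]]] := complement_splitting DA.
pose Z := ('rV[R]_p * 'rV[R]_(d - p))%type.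
pose ZW := (Z * 'rV[R]_p)%type.
pose XU := ('rV[R]_d * 'rV[R]_p)%type.
have fZ : finite_coord Z by apply: finite_coord_pair; exact: finite_coord_rV.
have frV n : finite_coord 'rV[R]_n := finite_coord_rV n.
(* First use: [w] as a function of [(u, v)]. *)
pose S1 : set ZW := [set z | U z.1.1].
pose X1 (z : ZW) : 'rV[R]_d := etaE z.1.1 + z.1.2 *m C + z.2 *m D.
have X1E u v w : X1 ((u, v), w) = etaE u + v *m C + w *m D by [].
pose F1 (z : ZW) := estimating_map r (X1 z, etaE z.1.1).
have c11 : continuous (fun z : ZW => z.1.1).
  by apply: (@finite_coord_continuous R _ _ (fst \o fst));
    exact: finite_coord_pair fZ (frV p).
have oS1 : open S1.
  by apply: (open_comp (f := fun z : ZW => z.1.1)) => // z _; exact: c11.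
have C11 k : Ck k S1 (fun z => z.1.1) := @Ck_linear R k _ _ S1 (fst \o fst) oS1 c11.
have c12 : continuous (fun z : ZW => z.1.2).
  by apply: (@finite_coord_continuous R _ _ (snd \o fst));
    exact: finite_coord_pair fZ (frV p).
have C12 k : Ck k S1 (fun z => z.1.2) := @Ck_linear R k _ _ S1 (snd \o fst) oS1 c12.
have c2 : continuous (fun z : ZW => z.2).
  by apply: (@finite_coord_continuous R _ _ snd); exact: finite_coord_pair fZ (frV p).
have C2 k : Ck k S1 (fun z => z.2) := @Ck_linear R k _ _ S1 snd oS1 c2.
have CE1 k : Ck k S1 (fun z => etaE z.1.1) :=
  Ck_comp oS1 (frV p) (fun z (Sz : S1 z) => Sz) (C11 k) (sE k).
have CX1 k : Ck k S1 X1 :=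
  Ck_add oS1 (Ck_add oS1 (CE1 k) (Ck_mulmx C oS1 (C12 k))) (Ck_mulmx D oS1 (C2 k)).
have sF1 : smooth_on S1 F1 := fun k => Ck_estimating_map r oS1 (CX1 k) (CE1 k).
pose z0 : Z := (u0, 0).
have S10 : S1 (z0, 0) by [].
have X10 u : X1 ((u, 0), 0) = etaE u by rewrite /X1 /= !mul0mx !addr0.
have F1diag u : F1 ((u, 0), 0) = 0.
  by rewrite /F1 X10; exact: estimating_map_diag er.
have dF1 h : 'd F1 (z0, 0) (0, h) = h.
  pose P1 (z : ZW) := (X1 z, etaE z.1.1).
  have dP1 : differentiable P1 (z0, 0) :=
    (Ck_pair oS1 (CX1 1%N) (CE1 1%N)).1 _ S10.
  have P10 : P1 (z0, 0) = (y0, y0) by rewrite /P1 X10.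
  have dR : differentiable (estimating_map r) (P1 (z0, 0)).
    exact: differentiable_estimating_map.
  have E1 : 'd F1 (z0, 0) (0, h) =
      'd (estimating_map r) (P1 (z0, 0)) ('d P1 (z0, 0) (0, h)) :=
    congr1 (fun f => f (0, h)) (diff_comp dP1 dR).
  have E2 : 'd P1 (z0, 0) (0, h) = (h *m D, 0).
    rewrite -deriveE //; apply: derive_along_line => t.
    have -> : t *: ((0, h) : ZW) + (z0, 0) = (z0, t *: h).
      by congr (_, _); rewrite /= ?scaler0 ?add0r ?addr0.
    congr (_, _) => /=.
      rewrite (X1E u0 0 (t *: h)) (X1E u0 0 0).
      by rewrite !mul0mx !addr0 addrAC subrr add0r scalemxAl.
    by rewrite subrr scaler0.
  by rewrite E1 E2 P10 (diff_estimating_map _ _ _ er) subr0 -mulmxA DA mulmx1.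
have [A1 [B1 [g1 [[oA1 oB1 A1z B1b] [sg1 AB1 gF1 uF1]]]]] :=
  implicit_function fZ oS1 S10 sF1 (F1diag u0) dF1.
(* Second use: [u] as a function of the point.  The factor [N] normalizes the
   partial differential [- B A^T] to the identity. *)
pose N := - invmx (B *m A^T).
pose S2 : set XU := [set z | U z.2].
pose F2 (z : XU) := estimating_map r (z.1, etaE z.2) *m N.
have cfst : continuous (fun z : XU => z.1).
  by move=> z; exact: cvg_fst.
have csnd : continuous (fun z : XU => z.2).
  by move=> z; exact: cvg_snd.
have oS2 : open S2.
  by apply: (open_comp (f := fun z : XU => z.2)) => // z _; exact: csnd.
have D1 k : Ck k S2 (fun z => z.1) := @Ck_linear R k _ _ S2 fst oS2 cfst.
have D2 k : Ck k S2 (fun z => z.2) := @Ck_linear R k _ _ S2 snd oS2 csnd.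
have CE2 k : Ck k S2 (fun z => etaE z.2) :=
  Ck_comp oS2 (frV p) (fun z (Sz : S2 z) => Sz) (D2 k) (sE k).
have CR2 k := Ck_estimating_map r oS2 (D1 k) (CE2 k).
have sF2 : smooth_on S2 F2 := fun k => Ck_mulmx N oS2 (CR2 k).
have S20 : S2 (y0, u0) by [].
have F20 : F2 (y0, u0) = 0.
  by rewrite /F2 /= (estimating_map_diag _ er) mul0mx.
have dF2 h : 'd F2 (y0, u0) (0, h) = h.
  pose P2 (z : XU) := (z.1, etaE z.2).
  have dfst : differentiable (fun z : XU => z.1) (y0, u0)
    := (D1 1%N).1 _ S20.
  have dsnd : differentiable (fun z : XU => z.2) (y0, u0)
    := (D2 1%N).1 _ S20.
  have dE : differentiable etaE u0 := (sE 1%N).1 _ Uu0.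
  have dE2 : differentiable (fun z : XU => etaE z.2) (y0, u0)
    := (CE2 1%N).1 _ S20.
  have dP2 : differentiable P2 (y0, u0) := differentiable_pair dfst dE2.
  have dR : differentiable (estimating_map r) (P2 (y0, u0)).
    exact: differentiable_estimating_map.
  have dRP := differentiable_comp dP2 dR.
  have cN : continuous (mulmxr N : 'rV[R]_p -> 'rV[R]_p).
    by apply: finite_coord_continuous; exact: frV.
  have E0 : 'd F2 (y0, u0) (0, h) =
      'd (mulmxr N : 'rV[R]_p -> 'rV[R]_p) (estimating_map r (P2 (y0, u0)))
        ('d (estimating_map r \o P2) (y0, u0) (0, h)) :=
    congr1 (fun f => f (0, h)) (diff_comp dRP (linear_differentiable _ cN)).
  have E1 : 'd (estimating_map r \o P2) (y0, u0) (0, h) =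
      'd (estimating_map r) (P2 (y0, u0)) ('d P2 (y0, u0) (0, h)) :=
    congr1 (fun f => f (0, h)) (diff_comp dP2 dR).
  have E2 : 'd P2 (y0, u0) (0, h) =
      ('d (fun z : XU => z.1) (y0, u0) (0, h),
       'd (fun z : XU => etaE z.2) (y0, u0) (0, h)) :=
    congr1 (fun f => f (0, h)) (diff_pair dfst dE2).
  have E3 : 'd (fun z : XU => z.1) (y0, u0) (0, h) = 0.
    exact: (congr1 (fun f => f (0, h)) (diff_lin (f := fst) (y0, u0) cfst)).
  have E4 : 'd (fun z : XU => etaE z.2) (y0, u0) (0, h) =
      'd etaE u0 ('d (fun z : XU => z.2) (y0, u0) (0, h)) :=
    congr1 (fun f => f (0, h)) (diff_comp dsnd dE).
  have E5 : 'd (fun z : XU => z.2) (y0, u0) (0, h) = h.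
    exact: (congr1 (fun f => f (0, h)) (diff_lin (f := snd) (y0, u0) csnd)).
  have E6 : 'd P2 (y0, u0) (0, h) = (0, h *m B) :=
    etrans E2 (congr2 pair E3
      (etrans E4 (etrans (congr1 ('d etaE u0) E5) (diff_jacobian etaE u0 h)))).
  have E7 : 'd (estimating_map r \o P2) (y0, u0) (0, h) = (0 - h *m B) *m A^T :=
    etrans E1 (etrans (congr1 ('d (estimating_map r) (P2 (y0, u0))) E6)
      (diff_estimating_map y0 0 (h *m B) er)).
  apply: etrans E0 _.
  apply: etrans (congr1 (fun f => f _) (diff_lin _ cN)) _.
  apply: etrans (congr1 (mulmx^~ N) E7) _.
  by rewrite sub0r /N mulmxN !mulNmx opprK -(mulmxA h) mulmxK.
have [A2 [B2 [g2 [[oA2 oB2 A2y B2u] [sg2 AB2 gF2 uF2]]]]] :=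
  implicit_function (frV d) oS2 S20 sF2 F20 dF2.
have F2eq X u : F2 (X, u) = 0 -> estimating_map r (X, etaE u) = 0.
  rewrite /F2 /N mulmxN => /eqP; rewrite oppr_eq0 => /eqP E.
  rewrite -(mulmxKV uBE (estimating_map r (X, etaE u))).
  by rewrite [_ *m invmx _]E mul0mx.
pose H (z : Z) := etaE z.1 + z.2 *m C + g1 z *m D.
have HE z : H z - etaE z.1 = z.2 *m C + g1 z *m D.
  by rewrite /H -[X in X - _]addrA [LHS]addrC addKr.
pose K (X : 'rV[R]_d) : Z := (g2 X, (X - etaE (g2 X)) *m C').
have UA1 z : A1 z -> U z.1 by move=> Az; exact: (AB1 z 0 Az B1b).
have UA2 X : A2 X -> U (g2 X) by move=> AX; exact: (AB2 X _ AX (gF2 X AX).1).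
have F1H z w :
    F1 (z, w) = estimating_map r (etaE z.1 + z.2 *m C + w *m D, etaE z.1) by [].
have eqH z : A1 z -> estimating_map r (H z, etaE z.1) = 0.
  by move=> /gF1 [_]; rewrite F1H.
have H0 u : A1 (u, 0) -> H (u, 0) = etaE u.
  move=> Au; have := uF1 (u, 0) 0 Au B1b (F1diag u).
  by rewrite /H /= => <-; rewrite !mul0mx !addr0.
have cz1 : continuous (fun z : Z => z.1) by move=> z; exact: cvg_fst.
have cz2 : continuous (fun z : Z => z.2) by move=> z; exact: cvg_snd.
have CH k : Ck k A1 H.
  apply: (Ck_add oA1 _ (Ck_mulmx D oA1 (sg1 k))).
  apply: (Ck_add oA1 _ (Ck_mulmx C oA1 (@Ck_linear R k _ _ A1 snd oA1 cz2))).
  exact: (Ck_comp oA1 (frV p) UA1 (@Ck_linear R k _ _ A1 fst oA1 cz1) (sE k)).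
have CEg k : Ck k A2 (fun X => etaE (g2 X)) :=
  Ck_comp oA2 (frV p) UA2 (sg2 k) (sE k).
have Cid k : Ck k A2 (fun X => X - etaE (g2 X)).
  have cid (V : normedModType R) : continuous (@idfun V) by move=> x.
  apply: (Ck_add oA2 (@Ck_linear R k _ _ A2 idfun oA2 (cid _))).
  apply: (Ck_eq_in oA2 _ (Ck_scale oA2 (Ck_cst k A2 (-1 : R)) (CEg k))) => X _.
  by rewrite scaleN1r.
have CK k : Ck k A2 K := Ck_pair oA2 (sg2 k) (Ck_mulmx C' oA2 (Cid k)).
(* The points at which both implicit solutions are available; on [O] uniqueness
   of the second one gives [K (H z) = z]. *)
pose O : set Z := [set z | A1 z /\ (A2 (H z) /\ B2 z.1 /\ W (H z))].
have oO : open O.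
  have -> : O = [set z | A1 z /\ (A2 `&` W) (H z)] `&` [set z | B2 z.1].
    by apply/seteqP; split => z; rewrite /O /=; tauto.
  apply: openI.
    by apply: (open_preimage_in oA1 (CH 0%N)); exact: openI.
  by apply: (open_comp (f := fun z : Z => z.1)) => // z _; exact: cz1.
have KH z : O z -> K (H z) = z.
  move=> [Az [A2H [B2z _]]].
  have g2H : g2 (H z) = z.1.
    by apply/esym; apply: uF2 => //; rewrite /F2 /= eqH // mul0mx.
  rewrite /K g2H HE.
  by rewrite mulmxDl -!mulmxA CC' DC' mulmx0 addr0 mulmx1 -surjective_pairing.
(* Uniqueness of the first solution describes the image of [O] by open
   conditions on the point. *)
have imO : H @` O = [set X | A2 X /\ O (K X)] `&`
    [set X | A2 X /\ B1 ((X - etaE (g2 X)) *m A^T)].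
  apply/seteqP; split => [X [z Oz <-]|X [[A2X OX] [_ B1X]]] /=.
    have [Az [A2H _]] := Oz; split; first by rewrite KH.
    split => //.
    have g2H : g2 (H z) = z.1 := congr1 fst (KH z Oz).
    rewrite g2H HE mulmxDl -!mulmxA DA CA mulmx0 add0r mulmx1.
    exact: (gF1 z Az).1.
  exists (K X) => //.
  have AK : A1 (K X) := OX.1.
  set w := _ *m A^T in B1X.
  have Xdec : X = etaE (K X).1 + (K X).2 *m C + w *m D.
    rewrite /K /w /= -addrA -!mulmxA -mulmxDr split1 mulmx1.
    by rewrite addrC subrK.
  have F1X : F1 (K X, w) = 0.
    rewrite F1H -Xdec; apply: F2eq; exact: (gF2 X A2X).2.
  by rewrite [RHS]Xdec /H (uF1 _ _ AK B1X F1X).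
have Oz0 : O z0.
  have Hz0 : H z0 = y0 by rewrite /z0 H0.
  by split => //; rewrite Hz0.
exists O, H; split; last first.
  move=> u v Ouv j; have := eqH (u, v) Ouv.1.
  by move=> /rowP /(_ j); rewrite !mxE.
split => //.
- exists K; split => //.
  + by move=> k; apply: Ck_sub (CH k) => z [].
  + rewrite imO; apply: openI.
      exact: (open_preimage_in oA2 (CK 0%N) oO).
    exact: (open_preimage_in oA2 (Ck_mulmx A^T oA2 (Cid 0%N)) oB1).
  + by move=> k; apply: Ck_sub (CK k) => X; rewrite imO => -[[]].
- by move=> X [z [_ [_ [_ WH]]] <-].
- by move=> u v [/UA1].
- by move=> u [/H0].
Qed.

End Existence.

(** * Second-order efficiency *)

Section Tangents.
Context {R : realType}.

Lemma open_slice_right (V W : normedModType R) (O : set (V * W)%type) u :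
  open O -> open [set v | O (u, v)].
Proof.
move=> oO; apply: (open_comp (f := fun v => (u, v))) => // v _.
by apply: cvg_pair; [exact: cvg_cst|exact: cvg_id].
Qed.

Lemma open_slice_left (V W : normedModType R) (O : set (V * W)%type) v :
  open O -> open [set u | O (u, v)].
Proof.
move=> oO; apply: (open_comp (f := fun u => (u, v))) => // u _.
by apply: cvg_pair; [exact: cvg_id|exact: cvg_cst].
Qed.

Lemma derive_natural_parameter d p (T : set 'rV[R]_d) psi th U
    (etaE : 'rV[R]_p -> 'rV[R]_d) u a i :
  diffeo_with_inverse T (grad psi) th -> smooth_on U etaE -> U u ->
  (grad psi @` T) (etaE u) ->
  'D_(evec R a) (fun u' => th (etaE u') 0 i) u =
    (jacobian etaE u *m fisher_eta psi th (etaE u)) a i.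
Proof.
move=> hth sE Uu [t Tt Et].
have dE : differentiable etaE u := (sE 1%N).1 u Uu.
have [dth Dth] := diff_natural_parameter hth Tt.
rewrite Et in dth Dth.
have E1 := diff_coord (evec R a) i (differentiable_comp dE dth).
apply: etrans (esym E1) _.
have E2 : 'd (th \o etaE) u (evec R a) = 'd th (etaE u) ('d etaE u (evec R a)) :=
  congr1 (fun f => f (evec R a)) (diff_comp dE dth).
apply: etrans (congr1 (fun x : 'rV[R]_d => x 0 i) E2) _.
apply: etrans (congr1 (fun x : 'rV[R]_d => x 0 i) (Dth _)) _.
apply: etrans (congr1 (fun x : 'rV[R]_d => (x *m fisher_eta psi th (etaE u)) 0 i)
  (diff_jacobian etaE u _)) _.
by rewrite -mulmxA /evec -rowE mxE.
Qed.

Lemma posdef_fisher_eta d (nu : {measure set (borel_rV R d) -> \bar R})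
    (Theta T : set 'rV[R]_d) psi th y :
  exponential_family nu Theta psi -> T `<=` Theta ->
  diffeo_with_inverse T (grad psi) th -> (grad psi @` T) y ->
  posdef (fisher_eta psi th y).
Proof.
move=> hfam TTheta [_ _ _ _ thK] [t Tt <-].
apply: posdef_inv; rewrite thK //; apply: (expfam_fisher_posdef hfam).
exact: TTheta.
Qed.

(** The tangent [d th / du_a] is a combination of the [e_j (etaE u)], and each
    of these pairs to zero with the second derivatives of [H] in [v]. *)
Lemma estimator_second_order_efficient d p (T : set 'rV[R]_d) psi th
    (U : set 'rV[R]_p) u0 (etaE : 'rV[R]_p -> 'rV[R]_d)
    (e : 'I_p -> 'I_d -> mpoly d R) r (O : set ('rV[R]_p * 'rV[R]_(d - p)))
    (H : 'rV[R]_p * 'rV[R]_(d - p) -> 'rV[R]_d) :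
  diffeo_with_inverse T (grad psi) th -> smooth_on U etaE ->
  etaE @` U `<=` grad psi @` T ->
  (forall j, pairing_mod_cubes (e j) (r j)) ->
  (forall u, U u -> exists M : 'M[R]_p,
     jacobian etaE u *m fisher_eta psi th (etaE u) = M *m value_matrix e (etaE u)) ->
  estimator U u0 etaE (grad psi @` T) O H ->
  estimating_equations r etaE O H ->
  second_order_efficient th O H.
Proof.
move=> hth sE UT er BG [Otrue [K [oO sH _ _ _]] _ Odom Oext] Heq u Ou k l a.
have Uu := Odom u 0 Ou.
pose O' := [set v | O (u, v)].
have oO' : open O' := open_slice_right u oO.
have CH n : Ck n O' (fun v => H (u, v)).
  have fW : finite_coord ('rV[R]_p * 'rV[R]_(d - p))%type.
    by apply: finite_coord_pair; exact: finite_coord_rV.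
  apply: (Ck_comp oO' fW (fun v (Ov : O' v) => Ov) _ (sH n)).
  apply: (Ck_pair oO' (Ck_cst n O' u) (@Ck_linear R n _ _ O' idfun oO' _)).
  by move=> x.
have H0 : H (u, 0) = etaE u := Oext u Ou.
have second j : \sum_i 'D_(evec R k) ('D_(evec R l) (fun v => H (u, v) 0 i)) 0 *
    meval (etaE u 0) (e j i) = 0.
  have [c Ec] := er j.
  apply: (estimating_curve_second_derivative (c := c) (O := O')
    (h := fun v => H (u, v))) => // v Ov.
  by rewrite /= H0 -Ec; exact: Heq.
have [M BGM] := BG u Uu.
have dtheta i : 'D_(evec R a) (fun u' => th (H (u', 0)) 0 i) u =
    \sum_j M a j * meval (etaE u 0) (e j i).
  apply: etrans (near_open_eq_derive (evec R a) (open_slice_left 0 oO) Ou _) _.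
    by move=> u' Ou' /=; rewrite (Oext u' Ou').
  rewrite (derive_natural_parameter a i hth sE Uu); last by apply: UT; exists u.
  by rewrite BGM mxE; apply: eq_bigr => j _; rewrite mxE.
transitivity (\sum_j M a j * \sum_i
    'D_(evec R k) ('D_(evec R l) (fun v => H (u, v) 0 i)) 0 *
    meval (etaE u 0) (e j i)); last first.
  by apply: big1 => j _; rewrite second mulr0.
transitivity (\sum_(i < d) \sum_j
  'D_(evec R k) ('D_(evec R l) (fun v => H (u, v) 0 i)) 0 *
   (M a j * meval (etaE u 0) (e j i))).
  by apply: eq_bigr => i _; rewrite dtheta mulr_sumr.
rewrite exchange_big; apply: eq_bigr => j _; rewrite mulr_sumr.
by apply: eq_bigr => i _; rewrite mulrCA.
Qed.

End Tangents.

(** * The theorem *)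

Theorem theorem4 (R : realType) (d p : nat) (hpd : (p < d)%N)
  (nu : {measure set (borel_rV R d) -> \bar R})
  (Theta : set 'rV[R]_d) (psi : 'rV[R]_d -> R)
  (hfam : exponential_family nu Theta psi)
  (VE : set 'rV[R]_d) (t0 : 'rV[R]_d)
  (hmodel : algebraic_curved_family p Theta psi VE t0)
  (T : set 'rV[R]_d) (th : 'rV[R]_d -> 'rV[R]_d)
  (hT : T t0 /\ T `<=` Theta)
  (hth : diffeo_with_inverse T (grad psi) th)
  (U : set 'rV[R]_p) (u0 : 'rV[R]_p) (etaE : 'rV[R]_p -> 'rV[R]_d)
  (hpar : regular_parametrization VE (grad psi t0) U u0 etaE)
  (hU : etaE @` U `<=` grad psi @` T)
  (hpoly : forall a : 'I_p, exists Q : mpoly d R,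
     forall u, U u -> u 0 a = meval (etaE u 0) Q)
  (e : 'I_p -> 'I_d -> mpoly d R)
  (he : forall u, U u ->
     (\matrix_(j < p, i < d) meval (etaE u 0) (e j i) :=:
      orthomx idfun 1%:M
        (orthomx idfun (fisher_eta psi th (etaE u)) (jacobian etaE u)))%MS)
  (s : nat) (G : 'I_s -> mpoly (d + d) R)
  (hG : groebner_basis (@ideal_I3 R d) G)
  (r : 'I_p -> mpoly (d + d) R)
  (hr : forall j, is_remainder G (pairing_X_eta (e j)) (r j)) :
  (forall j, (deg_eta (r j) <= 2)%N) /\
  ((exists (O : set ('rV[R]_p * 'rV[R]_(d - p)))
           (H : 'rV[R]_p * 'rV[R]_(d - p) -> 'rV[R]_d),
      estimator U u0 etaE (grad psi @` T) O H /\
      estimating_equations r etaE O H) /\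
   (forall (O : set ('rV[R]_p * 'rV[R]_(d - p)))
           (H : 'rV[R]_p * 'rV[R]_(d - p) -> 'rV[R]_d),
      estimator U u0 etaE (grad psi @` T) O H ->
      estimating_equations r etaE O H ->
      second_order_efficient th O H)).
Proof.
have form j : pairing_mod_cubes (e j) (r j).
  exact: eval_remainder hG (hr j).
have UW u : U u -> (grad psi @` T) (etaE u) by move=> Uu; apply: hU; exists u.
have pG u : U u -> posdef (fisher_eta psi th (etaE u)).
  by move=> /UW; exact: posdef_fisher_eta hfam hT.2 hth.
have BG u : U u -> exists M : 'M[R]_p,
    jacobian etaE u *m fisher_eta psi th (etaE u) = M *m value_matrix e (etaE u).
  move=> Uu; apply/submxP; rewrite (he u Uu).
  exact: mulmx_sub_orthomx (pG u Uu).1.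
have [oU [Uu0 Eu0] sE rE _ _ _] := hpar.
split; first by move=> j; exact: remainder_deg_eta hG (hr j).
split.
  have [M EM] := BG u0 Uu0.
  have [_ _ oW _ _] := hth.
  exact: estimator_exists oU Uu0 sE oW (UW u0 Uu0) form
    (pairing_unit (pG u0 Uu0) (rE u0 Uu0) EM).
move=> O H est eqs.
exact: estimator_second_order_efficient hth sE hU form BG est eqs.
Qed.
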